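(* Let $\Phi$ be a homogeneous Poisson point process with intensity $\lambda>0$ on $\mathbb{R}^d$, and let $\tilde R_o$ be the distance from the nucleus to a uniformly random point in the 0-cell $\tilde V_o$ of the Poisson-Voronoi tessellation of $\Phi$. Then the cumulative distribution function of $\tilde R_o$ is $$F_{\tilde R_o}(r)=1-\exp\left(-\lambda\kappa_d r^d\right),\qquad r\ge 0.$$
   Context: For $\mathbf{x}\in\Phi$, the Poisson-Voronoi cell with nucleus $\mathbf{x}$ is $V_{\mathbf{x}}=\{\mathbf{y}\in\mathbb{R}^d : \|\mathbf{y}-\mathbf{x}\|\le\|\mathbf{x}'-\mathbf{y}\|\ \ \forall \mathbf{x}'\in\Phi\}$. Almost surely there is a unique $\mathbf{x}_o\in\Phi$ such that the origin $o$ lies in $V_{\mathbf{x}_o}$; the 0-cell is $\tilde V_o=V_{\mathbf{x}_o}$ and its nucleus is $\mathbf{x}_o$. Conditionally on $\Phi$, let $\mathbf{y}$ be uniformly distributed on $\tilde V_o$; then $\tilde R_o=\|\mathbf{x}_o-\mathbf{y}\|$. The constant $\kappa_d=\pi^{d/2}/\Gamma(\frac d2+1)$ is the volume of the unit ball in $\mathbb{R}^d$. *)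

(* Defs.v *)
From HB Require Import structures.
From mathcomp Require Import all_boot all_order all_algebra.
From mathcomp Require Import all_classical all_reals all_analysis measurable_realfun.

Set Implicit Arguments.
Unset Strict Implicit.
Unset Printing Implicit Defensive.
Import Order.TTheory GRing.Theory Num.Theory.
Import numFieldNormedType.Exports.

Local Open Scope classical_set_scope.
Local Open Scope ring_scope.

(* R^n is [n.-tuple R], the type on which the library puts the product (Borel)
   sigma-algebra. *)

Section lebesgue_tuple.
Context {R : realType}.

(* [measurableTypeR R] is R with the (identical) sigma-algebra carried by
   [lebesgue_measure]. *)
Definition tuple_cons n (p : measurableTypeR R * n.-tuple R) : n.+1.-tuple R :=
  [the n.+1.-tuple R of (p.1 : R) :: p.2].

Definition tuple_uncons n (t : n.+1.-tuple R) : measurableTypeR R * n.-tuple R :=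
  (thead t : R, [tuple of behead t]).

Lemma tuple_consK n : cancel (@tuple_cons n) (@tuple_uncons n).
Proof.
by case=> x t; rewrite /tuple_uncons/= theadE; congr pair; exact: val_inj.
Qed.

Lemma measurable_tuple_cons n : measurable_fun setT (@tuple_cons n).
Proof.
apply: (@measurable_cons _ _ (measurableTypeR R * n.-tuple R)%type R fst n snd).
  exact: (@measurable_fst _ _ (measurableTypeR R) (n.-tuple R)).
exact: measurable_snd.
Qed.

Lemma measurable_tuple_uncons n : measurable_fun setT (@tuple_uncons n).
Proof.
apply/measurable_fun_pair; last exact: measurable_behead.
exact: (@measurable_tnth _ R n.+1 ord0).
Qed.

Section step.
Variables (n : nat) (mu : {sigma_finite_measure set (n.-tuple R) -> \bar R}).

Definition lebesgue_tuple_step : set (n.+1.-tuple R) -> \bar R :=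
  pushforward (@lebesgue_measure R \x mu)%E (@tuple_cons n).

Let step0 : lebesgue_tuple_step set0 = 0%E.
Proof.
rewrite /lebesgue_tuple_step /pushforward preimage_set0.
exact: (measure0 (@lebesgue_measure R \x mu)%E).
Qed.

Let step_ge0 A : (0 <= lebesgue_tuple_step A)%E.
Proof. by apply: (measure_ge0 (@lebesgue_measure R \x mu)%E). Qed.

Let step_sigma_additive : semi_sigma_additive lebesgue_tuple_step.
Proof.
move=> F mF tF mUF; rewrite /lebesgue_tuple_step /pushforward preimage_bigcup.
apply: (measure_semi_sigma_additive (s := (@lebesgue_measure R \x mu)%E)).
- by move=> k; rewrite -[X in measurable X]setTI; exact: measurable_tuple_cons.
- apply/trivIsetP => /= i j _ _ ij; rewrite -preimage_setI.
  by move/trivIsetP : tF => /(_ _ _ _ _ ij) ->//; rewrite preimage_set0.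
- by rewrite -preimage_bigcup -[X in measurable X]setTI;
    exact: measurable_tuple_cons.
Qed.

HB.instance Definition _ := isMeasure.Build _ _ _ lebesgue_tuple_step
  step0 step_ge0 step_sigma_additive.

Let step_sigma_finite : sigma_finite setT lebesgue_tuple_step.
Proof.
have /sigma_finiteP[F [TF ndF Foo]] := sigma_finiteT (@lebesgue_measure R).
have /sigma_finiteP[G [TG ndG Goo]] := sigma_finiteT mu.
exists (fun k => @tuple_uncons n @^-1` (F k `*` G k)) => [|k].
  rewrite -preimage_bigcup (_ : \bigcup_k _ = setT) ?preimage_setT//.
  rewrite -subTset => -[x t] _.
  have [i _ Fx] : (\bigcup_k F k) x by rewrite -TF.
  have [j _ Gt] : (\bigcup_k G k) t by rewrite -TG.
  exists (maxn i j) => //; split => /=.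
    by move: x Fx; exact/subsetPset/ndF/leq_maxl.
  by move: t Gt; exact/subsetPset/ndG/leq_maxr.
have [mF Foo'] := Foo k; have [mG Goo'] := Goo k; split.
  rewrite -[X in measurable X]setTI; apply: measurable_tuple_uncons => //.
  exact: measurableX.
rewrite /lebesgue_tuple_step /pushforward -comp_preimage.
have -> : @tuple_uncons n \o @tuple_cons n = id.
  by apply/funext => p; exact: tuple_consK.
rewrite preimage_id.
have -> := product_measure1E (@lebesgue_measure R) mu mF mG.
by rewrite lte_mul_pinfty// ge0_fin_numE.
Qed.

HB.instance Definition _ := @Measure_isSigmaFinite.Build _ _ _
  lebesgue_tuple_step step_sigma_finite.

End step.

Fixpoint lebesgue_tuple n : {sigma_finite_measure set (n.-tuple R) -> \bar R} :=
  match n with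
  | 0 => \d_([tuple] : 0.-tuple R)
  | n'.+1 => lebesgue_tuple_step (lebesgue_tuple n')
  end.

End lebesgue_tuple.

Section euclidean.
Context {R : realType} {d : nat}.
Implicit Types (x y : d.-tuple R) (B phi : set (d.-tuple R)).

Definition edist x y : R :=
  Num.sqrt (\sum_(i < d) (tnth x i - tnth y i) ^+ 2).

Definition origin : d.-tuple R := [tuple (0 : R) | _ < d].

Definition ebounded B := exists M : R, forall x, B x -> edist origin x <= M.

Definition voronoi_cell phi x : set (d.-tuple R) :=
  [set y | forall x', phi x' -> edist y x <= edist x' y].

End euclidean.

(* Gamma a is only meaningful for 0 < a. *)
Definition Gamma {R : realType} (a : R) : R :=
  \int[@lebesgue_measure R]_(t in `]0, +oo[) (t `^ (a - 1) * expR (- t)).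

Definition kappa {R : realType} (d : nat) : R :=
  pi `^ (d%:R / 2) / Gamma (d%:R / 2 + 1).

Section point_process.
Context {dO : measure_display} {Omega : measurableType dO} {R : realType}
  {d : nat} (P : probability Omega R).
Local Notation Rd := (d.-tuple R).
Implicit Types (Phi : Omega -> set Rd) (B : set Rd).

Definition npoints Phi B (w : Omega) : \bar R := counting (Phi w `&` B).

(* Mutual independence; it is enough to state the product rule for the whole
   family since some of the [C i] may be [setT]. *)
Definition independent_finite n (X : 'I_n -> Omega -> \bar R) :=
  forall C : 'I_n -> set (\bar R), (forall i, measurable (C i)) ->
  P (\bigcap_(i in [set: 'I_n]) (X i @^-1` C i)) =
  (\prod_(i < n) P (X i @^-1` C i))%E.

(* A point process is encoded as a random locally finite subset of R^d.  The
   Poisson weights are written out because [poisson_pmf 0 k] is 1 for all k,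
   which is wrong for Lebesgue-null sets B. *)
Record poisson_process (lambda : R) Phi : Prop := PoissonProcess {
  pp_locally_finite : forall w B, ebounded B -> finite_set (Phi w `&` B) ;
  pp_measurable : forall B, measurable B ->
    measurable_fun [set: Omega] (npoints Phi B) ;
  pp_poisson : forall B, measurable B -> ebounded B -> forall k : nat,
    let m := lambda * fine (lebesgue_tuple d B) in
    P [set w | npoints Phi B w = k%:R%:E] =
    (m ^+ k / k`!%:R * expR (- m))%:E ;
  pp_independent : forall n (B : 'I_n -> set Rd),
    (forall i, measurable (B i)) -> (forall i, ebounded (B i)) ->
    trivIset [set: 'I_n] B ->
    independent_finite (fun i => npoints Phi (B i)) }.

Definition sigma_process Phi : set (set Omega) :=
  <<s [set E | exists B C, [/\ measurable B, measurable C &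
                               E = npoints Phi B @^-1` C] ] >>.

(* The nucleus is a random point constrained only almost surely: its uniqueness
   holds only up to a null event, and is not assumed here. *)
Definition zero_cell_nucleus Phi (xo : Omega -> Rd) :=
  {ae P, forall w, Phi w (xo w) /\ voronoi_cell (Phi w) (xo w) origin}.

(* The random measure [B |-> |B `&` V| / |V|] is a conditional distribution
   of y given Phi.  That it is a version measurable with respect to
   [sigma_process Phi] up to null events is a property of V, not assumed here. *)
Definition conditionally_uniform Phi (V : Omega -> set Rd) (y : Omega -> Rd) :=
  forall E B, sigma_process Phi E -> measurable B ->
  P (E `&` y @^-1` B) =
  (\int[P]_(w in E)
     (fine (lebesgue_tuple d (B `&` V w)) / fine (lebesgue_tuple d (V w)))%:E)%E.

Definition nucleus_distance (xo y : {RV P >-> Rd}) : Omega -> R :=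
  fun w => edist (xo w) (y w).

Lemma measurable_nucleus_distance (xo y : {RV P >-> Rd}) :
  measurable_fun [set: Omega] (nucleus_distance xo y).
Proof.
have msqrt : measurable_fun [set: R] (@Num.sqrt R).
  by apply: continuous_measurable_fun; exact: sqrt_continuous.
apply: (measurableT_comp msqrt).
apply: (@measurable_sum _ _ _ _ _ _ (fun (i : 'I_d) (w : Omega) =>
  (tnth (xo w) i - tnth (y w) i) ^+ 2)) => i.
apply: measurable_funX; apply: measurable_funB.
  by apply: (measurableT_comp (measurable_tnth i)); exact: measurable_funPT.
by apply: (measurableT_comp (measurable_tnth i)); exact: measurable_funPT.
Qed.

HB.instance Definition _ (xo y : {RV P >-> Rd}) :=
  isMeasurableFun.Build _ _ _ _ (nucleus_distance xo y)
    (measurable_nucleus_distance xo y).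

End point_process.

(* Main.v *)
From Pilot Require Import Defs.
From HB Require Import structures.
From mathcomp Require Import all_boot all_order all_algebra.
From mathcomp Require Import all_classical all_reals all_analysis measurable_realfun.
From mathcomp Require Import ring lra.

Set Implicit Arguments.
Unset Strict Implicit.
Unset Printing Implicit Defensive.
Import Order.TTheory GRing.Theory Num.Theory.
Import numFieldNormedType.Exports.

Local Open Scope classical_set_scope.
Local Open Scope ring_scope.

(** Write [o] for the origin and [V] for the cell that contains it. The proof is a
    mass transport. Let a location [z] spread a unit mass uniformly over its own
    cell, so that the mass received by [u] has density [g z u] equal to the inverse
    of the volume of the cell when [z] and [u] share a cell, and to [0] otherwise.
    The density is symmetric ([cell_densityC]) and moves along with the points
    ([shift_cell_density]). Conditionally on the process, [y] has density [g o]
    ([joint_law]), and since [y] lies in the cell of [xo], its distance to [xo] is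
    its distance to the nearest point of the process. Hence
      P (|xo - y| <= r) = E \int g o u 1{the process has a point within r of u} du.
    The process is stationary, so translating by [- u] does not change the
    expectation of the integrand: it becomes that of
    [g (- u) o 1{the process has a point within r of o}]. Summing over [u], by
    symmetry and reflection, [g o] integrates to [1], and what remains is the
    probability that the ball of radius [r] around [o] is not empty
    ([near_uniform_point_probability]), that is [1 - exp (- lambda kappa r ^ d)].

    Stationarity ([stationary_expectation]) comes from the void probabilities:
    the events that a bounded Borel set misses the process are stable under
    intersection and have translation invariant probabilities, so the process and
    its translates have the same law on the sigma-algebra that these events
    generate. Everything else must then be measurable for that sigma-algebra. This
    is why cells are described through the balls that meet the process, up to a
    precision [1 / (n + 1)] that tends to [0] ([approx_common_cellP]).

    Three facts support the transport. The origin has almost surely a single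
    nearest point ([no_ties_at_origin]): two points at the same distance would fall
    into one of [n] shells of volume [O(1 / n)], each of which contains two points
    with probability [O(1 / n ^ 2)]. The volume of [V] is almost surely finite and
    positive ([total_cell_density]), as the conditional law of [y] has mass [1].
    Finally, [kappa r ^ d] is the volume of a ball ([lebesgue_tuple_closed_ball]),
    by the Gaussian integral. *)

(* The distance of R^d, not the extended distance of pseudometric spaces. *)
Local Notation edist := Pilot.Defs.edist.

(** * Euclidean distance, similarities and rational points *)

Section euclidean_metric.
Context {R : realType} {d : nat}.
Local Notation Rd := (d.-tuple R).
Implicit Types (x y z : Rd).

Lemma edist_ge0 x y : 0 <= edist x y.
Proof. exact: sqrtr_ge0. Qed.

Lemma edist_sqr x y : edist x y ^+ 2 = \sum_(i < d) (tnth x i - tnth y i) ^+ 2.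
Proof. by rewrite sqr_sqrtr// sumr_ge0// => i _; exact: sqr_ge0. Qed.

Lemma edistC x y : edist x y = edist y x.
Proof.
by congr Num.sqrt; apply: eq_bigr => i _; rewrite -sqrrN opprB.
Qed.

(** The quadratic form [|s a + t b|^2] is nonnegative; [s = - C] and [t = A] make
    it [A (A B - C ^ 2)]. *)
Lemma cauchy_schwarz_sum (a b : 'I_d -> R) :
  (\sum_i a i * b i) ^+ 2 <= (\sum_i a i ^+ 2) * (\sum_i b i ^+ 2).
Proof.
set A := \sum_i a i ^+ 2; set B := \sum_i b i ^+ 2; set C := \sum_i a i * b i.
have A0 : 0 <= A by apply: sumr_ge0 => i _; exact: sqr_ge0.
have h (s t : R) : 0 <= s ^+ 2 * A + (s * t * 2) * C + t ^+ 2 * B.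
  have -> : s ^+ 2 * A + (s * t * 2) * C + t ^+ 2 * B =
      \sum_i (s * a i + t * b i) ^+ 2.
    rewrite !mulr_sumr -!big_split/=; apply: eq_bigr => i _; ring.
  by apply: sumr_ge0 => i _; exact: sqr_ge0.
have [A_eq0|A_neq0] := eqVneq A 0.
  have C0 : C = 0.
    rewrite /C big1// => i _; have : a i ^+ 2 <= A.
      by rewrite /A (bigD1 i)//= lerDl sumr_ge0// => j _; exact: sqr_ge0.
    rewrite A_eq0 => ai; have /eqP : a i ^+ 2 = 0.
      by apply/eqP; rewrite eq_le ai sqr_ge0.
    by rewrite sqrf_eq0 => /eqP ->; rewrite mul0r.
  by rewrite C0 A_eq0 mul0r expr0n.
have Ap : 0 < A by rewrite lt_neqAle eq_sym A_neq0.
have := h (- C) A.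
have -> : (- C) ^+ 2 * A + (- C * A * 2) * C + A ^+ 2 * B = A * (A * B - C ^+ 2).
  by ring.
by rewrite pmulr_rge0// subr_ge0.
Qed.

Lemma euclidean_triangle y x z : edist x z <= edist x y + edist y z.
Proof.
rewrite -(@ler_pXn2r _ 2)// ?nnegrE ?addr_ge0 ?edist_ge0//.
rewrite sqrrD !edist_sqr.
set a := fun i => tnth x i - tnth y i; set b := fun i => tnth y i - tnth z i.
have -> : \sum_(i < d) (tnth x i - tnth z i) ^+ 2 =
    \sum_i a i ^+ 2 + (\sum_i a i * b i) *+ 2 + \sum_i b i ^+ 2.
  rewrite -sumrMnl -!big_split/=; apply: eq_bigr => i _; rewrite /a /b; ring.
rewrite lerD2r lerD2l lerMn2r/=.
apply: le_trans (ler_norm _) _.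
rewrite -(@ler_pXn2r _ 2)// ?nnegrE ?mulr_ge0 ?edist_ge0//.
by rewrite real_normK ?num_real// exprMn !edist_sqr cauchy_schwarz_sum.
Qed.

Lemma edist_eq0 x y : edist x y = 0 -> x = y.
Proof.
move=> xy0; apply: eq_from_tnth => i; apply/eqP; rewrite -subr_eq0 -sqrf_eq0.
rewrite eq_le sqr_ge0 andbT.
have -> : 0 = edist x y ^+ 2 by rewrite xy0 expr0n.
by rewrite edist_sqr (bigD1 i)//= lerDl sumr_ge0// => j _; exact: sqr_ge0.
Qed.

(** The similarity [x |-> c x + v]; its instances are the translations and the
    central reflection of the mass transport, and the dilations that compare the
    volumes of balls. *)
Definition affine (c : R) (v : Rd) x : Rd := [tuple c * tnth x i + tnth v i | i < d].

Lemma edist_affine c v x y :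
  edist (affine c v x) (affine c v y) = `|c| * edist x y.
Proof.
rewrite -sqrtr_sqr /edist -sqrtrM ?sqr_ge0//; congr Num.sqrt.
by rewrite mulr_sumr; apply: eq_bigr => i _; rewrite !tnth_mktuple; ring.
Qed.

Definition rational_point (q : d.-tuple rat) : Rd := map_tuple ratr q.

Lemma rational_point_dense x e : 0 < e -> exists q, edist x (rational_point q) < e.
Proof.
(* [d (e / (d + 1)) ^ 2 < e ^ 2], also for [d = 0]. *)
move=> e0; pose n := d.+1; pose h : R := e / n%:R.
have h0 : 0 < h by rewrite divr_gt0// ltr0n.
have ex i : exists q : rat, `|tnth x i - ratr q| < h.
  have /rat_in_itvoo[q] : tnth x i - h < tnth x i + h by lra.
  rewrite in_itv/= => /andP[q1 q2]; exists q.
  by rewrite ltr_norml; apply/andP; split; lra.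
pose q := [tuple projT1 (cid (ex i)) | i < d]; exists q.
rewrite -(@ltr_pXn2r _ 2)// ?nnegrE ?edist_ge0 ?ltW//.
rewrite edist_sqr; apply: (@le_lt_trans _ _ (\sum_(i < d) h ^+ 2)).
  apply: ler_sum => i _; rewrite tnth_map tnth_mktuple; case: cid => s /= hs.
  by rewrite -[leLHS]real_normK ?num_real// ler_pXn2r// ?nnegrE ?ltW.
rewrite sumr_const card_ord -mulr_natl exprMn mulrCA gtr_pMr ?exprn_gt0//.
rewrite exprVn ltr_pdivrMr ?mul1r ?exprn_gt0 ?ltr0n//.
by rewrite -natrX ltr_nat expnS expn1 /n mulSn ltn_addr.
Qed.

End euclidean_metric.

Section measurable_edist.
Context {R : realType} {d : nat}.
Local Notation Rd := (d.-tuple R).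

Lemma measurable_edist dT (T : measurableType dT) (f g : T -> Rd) :
  measurable_fun setT f -> measurable_fun setT g ->
  measurable_fun setT (fun t => edist (f t) (g t)).
Proof.
move=> mf mg.
have msqrt : measurable_fun [set: R] (@Num.sqrt R).
  by apply: continuous_measurable_fun; exact: sqrt_continuous.
apply: (measurableT_comp msqrt).
apply: (@measurable_sum _ _ _ _ _ _ (fun (i : 'I_d) (t : T) =>
  (tnth (f t) i - tnth (g t) i) ^+ 2)) => i.
by apply: measurable_funX; apply: measurable_funB;
  apply: (measurableT_comp (measurable_tnth i)).
Qed.

Lemma measurable_affine c (v : Rd) : measurable_fun setT (affine c v).
Proof.
apply/measurable_fun_tnthP => i /=.
rewrite (_ : _ \o _ = fun x => c * tnth x i + tnth v i); last first.
  by apply/funext => x /=; rewrite tnth_mktuple.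
apply: measurable_funD; last exact: measurable_cst.
by apply: measurable_funM; [exact: measurable_cst|exact: measurable_tnth].
Qed.

Lemma measurable_edist_lt dT (T : measurableType dT) (f g : T -> Rd) r :
  measurable_fun setT f -> measurable_fun setT g ->
  measurable [set t | edist (f t) (g t) < r].
Proof.
move=> mf mg; rewrite -[X in measurable X]setTI.
have := measurable_edist mf mg measurableT (measurable_itv `]-oo, r[).
by congr (measurable (_ `&` _)); apply/seteqP; split => t; rewrite /= in_itv.
Qed.

Lemma measurable_edist_le dT (T : measurableType dT) (f g : T -> Rd) r :
  measurable_fun setT f -> measurable_fun setT g ->
  measurable [set t | edist (f t) (g t) <= r].
Proof.
move=> mf mg; rewrite -[X in measurable X]setTI.
have := measurable_edist mf mg measurableT (measurable_itv `]-oo, r]).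
by congr (measurable (_ `&` _)); apply/seteqP; split => t; rewrite /= in_itv.
Qed.

End measurable_edist.

(** * Lebesgue measure under similarities *)

Section lebesgue_tuple_integral.
Context {R : realType}.
Local Notation mu := (@lebesgue_measure R).

Lemma ge0_integral_lebesgue_tupleS n (f : n.+1.-tuple R -> \bar R) :
  measurable_fun setT f -> (forall t, 0 <= f t)%E ->
  (\int[@lebesgue_tuple R n.+1]_t f t =
   \int[mu]_x \int[@lebesgue_tuple R n]_t f (tuple_cons (x, t)))%E.
Proof.
move=> mf f0.
have := @ge0_integral_pushforward _ _ _ _ R (@tuple_cons R n)
  (@measurable_tuple_cons R n) (mu \x lebesgue_tuple n)%E setT f measurableT mf
  (fun x _ => f0 x).
rewrite preimage_setT => ->.
have := @fubini_tonelli1 _ _ _ _ R mu (lebesgue_tuple n) (f \o @tuple_cons R n).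
rewrite /fubini_F /= => -> //.
by apply: measurableT_comp => //; exact: measurable_tuple_cons.
Qed.

Section affine_line.
Variables (c v : R).
Hypothesis c_neq0 : c != 0.

Definition line_affine (x : measurableTypeR R) : measurableTypeR R := c * x + v.

Lemma measurable_line_affine : measurable_fun setT line_affine.
Proof.
apply: measurable_funD; last exact: measurable_cst.
by apply: measurable_funM; [exact: measurable_cst|exact: measurable_id].
Qed.

Let image : {measure set (measurableTypeR R) -> \bar R}.
Proof. by refine (pushforward mu line_affine); exact: measurable_line_affine. Defined.

Let nu := mscale (NngNum (normr_ge0 c)) image.

Lemma lebesgue_measure_affine (A : set R) : measurable A ->
  (`|c|%:E * mu (line_affine @^-1` A) = mu A)%E.
Proof.
move=> mA; have -> : (`|c|%:E * mu (line_affine @^-1` A) = nu A)%E by [].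
apply/esym/(@lebesgue_measure_unique R nu) => // _ [[a b] _ <-].
rewrite -[RHS]/(`|c|%:E * mu (line_affine @^-1` `]a, b]%classic))%E.
rewrite lebesgue_measure_itv/= lte_fin.
have [c0|c0] := ltP 0 c.
  have -> : line_affine @^-1` `]a, b] = `](a - v) / c, (b - v) / c]%classic.
    apply/seteqP; split => x /=; rewrite /line_affine !in_itv/=;
      by rewrite ltr_pdivrMr// ler_pdivlMr// mulrC ltrBlDr lerBrDr.
  rewrite lebesgue_measure_itv/= lte_fin ltr_pM2r ?invr_gt0// ltrD2r.
  case: ifPn; last by rewrite mule0.
  by rewrite -!EFinB -EFinM gtr0_norm// => _; congr EFin; field; rewrite gt_eqF.
have {}c0 : c < 0 by rewrite lt_neqAle c_neq0.
have -> : line_affine @^-1` `]a, b] = `[(b - v) / c, (a - v) / c[%classic.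
  apply/seteqP; split => x /=; rewrite /line_affine !in_itv/= andbC;
    by rewrite ltr_ndivlMr// ler_ndivrMr// mulrC ltrBlDr lerBrDr.
rewrite lebesgue_measure_itv/= lte_fin ltr_nM2r ?invr_lt0// ltrD2r.
case: ifPn; last by rewrite mule0.
by rewrite -!EFinB -EFinM ltr0_norm// => _; congr EFin; field; rewrite lt_eqF.
Qed.

Lemma ge0_integral_affine (f : R -> \bar R) :
  measurable_fun setT f -> (forall x, 0 <= f x)%E ->
  (`|c|%:E * \int[mu]_x f (line_affine x) = \int[mu]_x f x)%E.
Proof.
move=> mf f0.
have := @ge0_integral_pushforward _ _ _ _ R line_affine
  measurable_line_affine mu setT f measurableT mf (fun x _ => f0 x).
rewrite preimage_setT => <-.
rewrite -(@ge0_integral_mscale _ _ _ image setT _ (NngNum (normr_ge0 c)) f)//.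
apply: eq_measure_integral => A mA _.
by have := lebesgue_measure_affine mA.
Qed.

End affine_line.

(** One coordinate at a time: each contributes a factor [`|c|]. *)
Lemma ge0_integral_lebesgue_tuple_affine n (c : R) (v : n.-tuple R)
    (f : n.-tuple R -> \bar R) : c != 0 ->
  measurable_fun setT f -> (forall t, 0 <= f t)%E ->
  ((`|c| ^+ n)%:E * \int[@lebesgue_tuple R n]_t f (affine c v t) =
   \int[@lebesgue_tuple R n]_t f t)%E.
Proof.
move=> c0; elim: n v f => [|n IH] v f mf f0.
  rewrite expr0 mul1e; apply: eq_integral => t _; congr f.
  by rewrite [LHS]tuple0 [RHS]tuple0.
have maff := measurable_affine c v.
have mfa : measurable_fun setT (fun t => f (affine c v t)).
  exact: (measurableT_comp mf maff).
rewrite !ge0_integral_lebesgue_tupleS//.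
pose F x := (\int[@lebesgue_tuple R n]_t f (tuple_cons (x, t)))%E.
have mcons : measurable_fun setT (fun p : measurableTypeR R * n.-tuple R => f (tuple_cons p)).
  by apply: measurableT_comp => //; exact: measurable_tuple_cons.
have mF : measurable_fun setT F.
  exact: (@measurable_fun_fubini_tonelli_F _ _ _ _ R (lebesgue_tuple n)
    (fun p => f (tuple_cons p))).
have F0 x : (0 <= F x)%E by exact: integral_ge0.
rewrite -/(F _) -(ge0_integral_affine (tnth v ord0) c0 mF F0) exprS EFinM -muleA.
congr (_ * _)%E; rewrite -ge0_integralZl//; last 2 first.
- apply: (@measurable_fun_fubini_tonelli_F _ _ _ _ R (lebesgue_tuple n)
    (fun p => f (affine c v (tuple_cons p)))) => //.
  by apply: (measurableT_comp mfa); exact: measurable_tuple_cons.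
- by move=> x _; exact: integral_ge0.
apply: eq_integral => x _; rewrite /F.
apply: etrans (IH [tuple of behead v]
  (fun t => f (tuple_cons (line_affine c (tnth v ord0) x, t))) _ _) => //.
  congr (_ * _)%E; apply: eq_integral => t _; congr f.
  apply: eq_from_tnth => i; rewrite tnth_mktuple; case: (unliftP ord0 i) => [j|] ->.
    by rewrite !tnthS tnth_mktuple/= [in X in _ + X](tuple_eta v) tnthS.
  by rewrite !tnth0.
exact: (measurable_fun_pair2 _ mcons).
Qed.

Lemma lebesgue_tuple_affine n (c : R) (v : n.-tuple R) (B : set (n.-tuple R)) :
  c != 0 -> measurable B ->
  ((`|c| ^+ n)%:E * lebesgue_tuple n (affine c v @^-1` B) = lebesgue_tuple n B)%E.
Proof.
move=> c0 mB.
have E C : measurable C ->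
    lebesgue_tuple n C = (\int[@lebesgue_tuple R n]_t (\1_C t)%:E)%E.
  by move=> mC; rewrite integral_indic// setIT.
rewrite !E//; last by rewrite -[X in measurable X]setTI; exact: measurable_affine.
rewrite -(ge0_integral_lebesgue_tuple_affine v c0 (f := fun t => (\1_B t)%:E))//.
by apply/measurable_EFinP; exact: measurable_indic.
Qed.

End lebesgue_tuple_integral.

(** * The volume of a ball *)

Section ball_volume.
Context {R : realType}.
Local Notation mu := (@lebesgue_measure R).

Definition closed_ball_at_origin d (r : R) : set (d.-tuple R) :=
  [set x | edist origin x <= r].

Lemma measurable_closed_ball_at_origin d r :
  measurable (@closed_ball_at_origin d r).
Proof. exact: measurable_edist_le. Qed.

Lemma edist_origin_cons n (x : R) (t : n.-tuple R) :
  edist origin (tuple_cons (x : measurableTypeR R, t)) ^+ 2 =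
  x ^+ 2 + edist origin t ^+ 2.
Proof.
rewrite !edist_sqr big_ord_recl !tnth_mktuple tnth0 sub0r sqrrN; congr (_ + _).
by apply: eq_bigr => i _; rewrite !tnth_mktuple tnthS.
Qed.

Lemma measurable_edist_origin d : measurable_fun setT (@edist R d origin).
Proof.
by apply: measurable_edist; [exact: measurable_cst|exact: measurable_id].
Qed.

Lemma measurable_gauss_edist d :
  measurable_fun setT (fun x : d.-tuple R => expR (- edist origin x ^+ 2)).
Proof.
apply: measurableT_comp => //; apply: measurableT_comp => //.
by apply: measurable_funX; exact: measurable_edist_origin.
Qed.

Lemma integral_gauss_tuple d :
  (\int[@lebesgue_tuple R d]_x (expR (- edist origin x ^+ 2))%:E =
   (Num.sqrt pi ^+ d)%:E)%E.
Proof.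
elim: d => [|d IH].
  rewrite integral_dirac//; last first.
    by apply/measurable_EFinP; exact: measurable_gauss_edist.
  by rewrite diracT mul1e edist_sqr big_ord0 oppr0 expR0 expr0.
rewrite ge0_integral_lebesgue_tupleS; last 2 first.
- by apply/measurable_EFinP; exact: measurable_gauss_edist.
- by move=> t; rewrite lee_fin expR_ge0.
under eq_integral => x _.
  under eq_integral => t _ do
    rewrite edist_origin_cons opprD expRD EFinM.
  rewrite ge0_integralZl//; last first.
    by apply/measurable_EFinP; exact: measurable_gauss_edist.
  rewrite IH.
  over.
rewrite ge0_integralZr//; last first.
  by apply/measurable_EFinP; exact: measurable_gauss_fun.
by rewrite (@integralT_gauss R) -EFinM -exprS.
Qed.

Lemma integral_expRN (s : R) :
  (\int[mu]_(t in `[s, +oo[) (expR (- t))%:E = (expR (- s))%:E)%E.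
Proof.
have cexp : continuous (fun z : R^o => expR (- z)).
  by move=> z; apply: continuous_comp; [exact: opp_continuous|exact: continuous_expR].
rewrite (@ge0_continuous_FTC2y _ _ (fun t => - expR (- t)) _ 0).
- by rewrite EFinN oppeK add0e.
- by move=> x _; exact: expR_ge0.
- exact: continuous_subspaceT.
- by rewrite -oppr0; apply: cvgN; exact: cvgr_expR.
- by move=> x _; exact: ex_derive.
- by apply: cvg_at_right_filter; apply: cvgN; exact: cexp.
- move=> z _; rewrite derive1N//.
  rewrite derive1_comp// derive1N// derive1_id derive1E.
  have /funeqP -> := @derive_expR R.
  by rewrite mulrN1 opprK.
Qed.

End ball_volume.

Section ball_volume_formula.
Context {R : realType}.
Local Notation mu := (@lebesgue_measure R).

(* The function [exp (- s)] as a superposition of indicators of [s <= t]. *)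
Let layer_indic (s : R) :
  (\int[mu]_t ((s <= t)%R%:R * expR (- t))%:E = (expR (- s))%:E)%E.
Proof.
rewrite -integral_expRN [RHS]integral_mkcond; apply: eq_integral => t _.
rewrite patchE; have [st|st] := lerP s t.
  by rewrite ifT ?mul1r// inE/= in_itv/= st.
by rewrite ifF ?mul0r//; apply/negbTE; rewrite notin_setE/= in_itv/= leNgt st.
Qed.

Lemma lebesgue_tuple_closed_ball_scale d r : 0 < r ->
  lebesgue_tuple d (@closed_ball_at_origin R d r) =
  ((r ^+ d)%:E * lebesgue_tuple d (@closed_ball_at_origin R d 1))%E.
Proof.
move=> r0.
rewrite -(@lebesgue_tuple_affine R d r origin (closed_ball_at_origin r)) ?gt_eqF//; last first.
  exact: measurable_closed_ball_at_origin.
rewrite gtr0_norm//; congr (_ * lebesgue_tuple d _)%E.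
have E x : edist origin (affine r origin x) = r * edist origin x.
  rewrite -[X in edist X (affine _ _ _)](_ : affine r origin origin = origin).
    by rewrite edist_affine gtr0_norm.
  by apply: eq_from_tnth => i; rewrite !tnth_mktuple mulr0 add0r.
by apply/seteqP; split => x; rewrite /closed_ball_at_origin /= E ger_pMr.
Qed.

Local Notation gamma_integrand d t := ((t `^ (d%:R / 2 + 1 - 1) * expR (- t))%R).

(** Both sides are the integral of [exp (- |x|^2)] over the space: by Tonelli it
    is a power of the Gaussian integral, and slicing the function along its level
    sets, which are balls of radius [sqrt t], produces the Gamma integral. *)
Lemma unit_ball_volume_Gamma d :
  (lebesgue_tuple d (@closed_ball_at_origin R d 1) *
   \int[mu]_(t in `]0%R, +oo[) (gamma_integrand d t)%:E =
   (pi `^ (d%:R / 2))%:E)%E.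
Proof.
have -> : pi `^ (d%:R / 2) = Num.sqrt pi ^+ d :> R.
  by rewrite -powR12_sqrt ?pi_ge0// -powR_mulrn ?powR_ge0// -powRrM mulrC.
rewrite -integral_gauss_tuple.
pose S := (d.-tuple R * measurableTypeR R)%type.
have mF : measurable_fun setT (fun p : S =>
    ((edist origin p.1 ^+ 2 <= p.2)%R%:R * expR (- p.2))%:E).
  have m1 : measurable_fun setT (fun p : S => edist origin p.1 ^+ 2).
    apply: measurable_funX.
    by apply: measurable_edist; [exact: measurable_cst|exact: measurable_fst].
  have m2 : measurable_fun setT (fun p : S => (p.2 : R)).
    exact: measurable_snd.
  apply/measurable_EFinP; apply: measurable_funM.
    apply: (measurableT_comp (f := fun b : bool => b%:R : R)) => //.
    exact: measurable_fun_ler.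
  by apply: measurableT_comp => //; exact: measurableT_comp.
have F0 (p : S) :
    (0 <= ((edist origin p.1 ^+ 2 <= p.2)%R%:R * expR (- p.2))%:E :> \bar R)%E.
  by move: p => [x t]; rewrite lee_fin mulr_ge0 ?expR_ge0.
under [RHS]eq_integral => x _ do rewrite -layer_indic.
have := @fubini_tonelli _ _ (d.-tuple R) (measurableTypeR R) R (lebesgue_tuple d) mu _ mF F0.
move=> /= ->.
(* No point has [|x| ^ 2 <= t] when [t < 0]. *)
rewrite [RHS](_ : _ = \int[mu]_(t in `[0%R, +oo[)
    \int[lebesgue_tuple d]_x ((edist origin x ^+ 2 <= t)%R%:R * expR (- t))%:E)%E; last first.
  rewrite [RHS]integral_mkcond; apply: eq_integral => t _; rewrite patchE.
  case: ifPn => //; rewrite notin_setE/= in_itv/= andbT => /negP t0.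
  apply: integral0_eq => x _; rewrite leNgt (lt_le_trans _ (sqr_ge0 _)) ?ltNge//.
  by rewrite mul0r.
rewrite -integral_itv_obnd_cbnd; last first.
  apply: measurable_funTS.
  exact: (@measurable_fun_fubini_tonelli_G _ _ _ _ R (lebesgue_tuple d) _ mF F0).
rewrite -ge0_integralZl//; last 2 first.
- apply/measurable_EFinP; apply: measurable_funM.
    by apply: measurable_funTS; exact: measurable_powR.
  by apply: measurableT_comp => //; exact: measurableT_comp.
- by move=> t _; rewrite lee_fin mulr_ge0 ?powR_ge0 ?expR_ge0.
apply: eq_integral => t; rewrite inE/= in_itv/= andbT => t0.
under [RHS]eq_integral => x _ do rewrite EFinM.
rewrite ge0_integralZr ?lee_fin ?expR_ge0//; last first.
  apply/measurable_EFinP; apply: (measurableT_comp (f := fun b : bool => b%:R : R)) => //.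
  apply: measurable_fun_ler; last exact: measurable_cst.
  by apply: measurable_funX; exact: measurable_edist_origin.
rewrite EFinM muleA; congr (_ * _)%E.
have s0 : 0 < Num.sqrt t by rewrite sqrtr_gt0.
rewrite addrK muleC (_ : t `^ _ = Num.sqrt t ^+ d); last first.
  by rewrite -powR12_sqrt ?ltW// -powR_mulrn ?powR_ge0// -powRrM mulrC.
rewrite -lebesgue_tuple_closed_ball_scale//.
have mB := @measurable_closed_ball_at_origin R d (Num.sqrt t).
transitivity (\int[@lebesgue_tuple R d]_x (\1_(closed_ball_at_origin (Num.sqrt t)) x)%:E)%E.
  by rewrite integral_indic// setIT.
apply: eq_integral => x _; rewrite indicE; congr ((nat_of_bool _)%:R%:E).
rewrite -[X in _ <= X](sqr_sqrtr (ltW t0)) ler_pXn2r// ?nnegrE ?edist_ge0// ?sqrtr_ge0//.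
by apply/idP/idP; rewrite inE.
Qed.

Lemma lebesgue_tuple_closed_ball d r : (0 < d)%N -> 0 <= r ->
  lebesgue_tuple d (@closed_ball_at_origin R d r) = (kappa d * r ^+ d)%:E.
Proof.
move=> d0 r0; have := unit_ball_volume_Gamma d.
rewrite /kappa /Gamma /Rintegral.
set V := lebesgue_tuple d _; set G := (\int[mu]_(t in _) _)%E; set p := pi `^ _.
have V0 : (0 <= V)%E by exact: measure_ge0.
have G0 : (0 <= G)%E.
  by apply: integral_ge0 => t _; rewrite lee_fin mulr_ge0 ?powR_ge0 ?expR_ge0.
have p0 : 0 < p by rewrite powR_gt0// pi_gt0.
(* A product of nonnegative extended reals that is positive and finite has
   positive finite factors. *)
have V_lt : V != 0%E /\ V != +oo%E /\ G != 0%E /\ G != +oo%E -> (V * G = p%:E)%E ->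
    V = (p / fine G)%:E.
  move=> [Vn0 [Vnoo [Gn0 Gnoo]]].
  have Vf : V \is a fin_num by rewrite ge0_fin_numE// lt_neqAle Vnoo leey.
  have Gf : G \is a fin_num by rewrite ge0_fin_numE// lt_neqAle Gnoo leey.
  rewrite -(fineK Vf) -(fineK Gf) -EFinM => -[<-]; congr EFin.
  by rewrite mulfK//; apply: contra Gn0 => /eqP G0'; rewrite -(fineK Gf) G0'.
move=> VGp; have {V_lt} VE : V = (p / fine G)%:E.
  apply: V_lt => //; split; [|split; [|split]]; apply/eqP => E; move: VGp; rewrite E.
  - by rewrite mul0e => -[p00]; rewrite -p00 ltxx in p0.
  - have [->|Gn0] := eqVneq G 0%E.
      by rewrite mule0 => -[p00]; rewrite -p00 ltxx in p0.
    by rewrite gt0_mulye// lt_neqAle eq_sym Gn0.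
  - by rewrite mule0 => -[p00]; rewrite -p00 ltxx in p0.
  - have [->|Vn0] := eqVneq V 0%E.
      by rewrite mul0e => -[p00]; rewrite -p00 ltxx in p0.
    by rewrite gt0_muley// lt_neqAle eq_sym Vn0.
have pos s : 0 < s ->
    lebesgue_tuple d (@closed_ball_at_origin R d s) = (p / fine G * s ^+ d)%:E.
  by move=> s0; rewrite lebesgue_tuple_closed_ball_scale// -/V VE -EFinM mulrC.
have [/eqP r_eq0|r_neq0] := boolP (r == 0); last first.
  by apply: pos; rewrite lt_neqAle eq_sym r_neq0.
(* The ball of radius [0] is contained in balls of volume at most [e]. *)
rewrite r_eq0 expr0n gtn_eqF// mulr0; apply/eqP; rewrite eq_le measure_ge0 andbT.
apply/lee_addgt0Pr => e e0; rewrite add0e.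
pose c := p / fine G; pose s := Num.min 1 (e / (`|c| + 1)).
have c1 : 0 < `|c| + 1 by rewrite ltr_wpDl.
have s0 : 0 < s by rewrite lt_min ltr01 divr_gt0.
apply: (@le_trans _ _ (lebesgue_tuple d (@closed_ball_at_origin R d s))).
  apply: le_measure; rewrite ?inE; [exact: measurable_closed_ball_at_origin..|].
  by move=> x /= x0; exact: le_trans x0 (ltW s0).
rewrite pos// lee_fin -/c.
apply: (@le_trans _ _ (`|c| * s)).
  rewrite (le_trans (ler_norm _))// normrM ler_wpM2l//.
  rewrite ger0_norm ?exprn_ge0 ?(ltW s0)// -(prednK d0) exprS ger_pMr//.
  by rewrite exprn_ile1 ?(ltW s0)// ge_min lexx.
apply: (@le_trans _ _ ((`|c| + 1) * (e / (`|c| + 1)))).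
  apply: ler_pM => //; [exact: ltW|by rewrite lerDl|by rewrite ge_min lexx orbT].
by rewrite mulrCA divff ?mulr1// gt_eqF.
Qed.

End ball_volume_formula.

(** * Configurations and the geometry of their cells *)

Section measurable_quantifiers.
Context {dT : measure_display} {T : measurableType dT}.

Lemma measurable_exists (I : Type) (P : I -> T -> Prop) : countable [set: I] ->
  (forall i, measurable [set t | P i t]) -> measurable [set t | exists i, P i t].
Proof.
move=> cI mP; rewrite (_ : [set t | _] = \bigcup_i [set t | P i t]).
  exact: countable_bigcupT_measurable.
by apply/seteqP; split => t [i]; [exists i|move=> _; exists i].
Qed.

Lemma measurable_not (P : T -> Prop) :
  measurable [set t | P t] -> measurable [set t | ~ P t].
Proof. by move=> mP; exact: measurableC. Qed.

Lemma measurable_forall_nat (P : nat -> T -> Prop) :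
  (forall n, measurable [set t | P n t]) -> measurable [set t | forall n, P n t].
Proof.
move=> mP; rewrite (_ : [set t | _] = \bigcap_n [set t | P n t]).
  exact: bigcapT_measurable.
by apply/seteqP; split => t Pt n; [move=> _; exact: Pt|exact: (Pt n I)].
Qed.

End measurable_quantifiers.

Section configurations.
Context {R : realType} {d : nat}.
Local Notation Rd := (d.-tuple R).
Implicit Types (phi : set Rd) (x y z u v q : Rd) (B : set Rd).

Definition void_events : set (set (set Rd)) :=
  [set E | exists B, [/\ measurable B, ebounded B &
                         E = [set phi | phi `&` B = set0] ] ].

(** The sigma-algebra of void events suffices because every quantity used below
    is a function of which balls contain a point; and the void events are stable
    under intersection, so that a law is determined by its void probabilities. *)
Definition configuration : Type := g_sigma_algebraType void_events.

HB.instance Definition _ := Measurable.on configuration.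

Lemma ebounded_open_ball q e : ebounded [set x | edist x q < e].
Proof.
exists (edist origin q + e) => x /= xq.
by rewrite (le_trans (euclidean_triangle q _ _))// lerD2l edistC ltW.
Qed.

Lemma measurable_void_event B : measurable B -> ebounded B ->
  measurable [set phi : configuration | phi `&` B = set0].
Proof. by move=> mB bB; apply: sub_sigma_algebra; exists B. Qed.

Definition hits3 phi z y u (a b c : R) :=
  exists x, [/\ phi x, edist x z < a, edist x y < b & edist x u < c].

Definition hits phi z (a : R) := exists x, phi x /\ edist x z < a.

Section measurable_hits.
Context {dT : measure_display} {T : measurableType dT}.
Variables (F : T -> configuration) (mF : measurable_fun setT F).

(** A point of the configuration near [z t] is detected by a ball with rational
    centre, so that the configuration and the location [z t] separate. *)
Lemma measurable_hits3 (z y u : T -> Rd) (a b c : R) :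
  measurable_fun setT z -> measurable_fun setT y -> measurable_fun setT u ->
  measurable [set t | hits3 (F t) (z t) (y t) (u t) a b c].
Proof.
move=> mz my mu.
pose P (qj : d.-tuple rat * nat) (t : T) :=
  let q := rational_point qj.1 : Rd in let e := qj.2.+1%:R^-1 : R in
  [/\ ~ (F t `&` [set x | edist x q < e] = set0), edist q (z t) < a - e,
      edist q (y t) < b - e & edist q (u t) < c - e].
rewrite (_ : [set t | _] = [set t | exists qj, P qj t]).
  apply: measurable_exists; first exact: countableP.
  move=> [q j]; rewrite /P/=.
  set e := j.+1%:R^-1; set q' := rational_point q.
  rewrite (_ : [set t | _] =
    [set t | ~ (F t `&` [set x | edist x q' < e] = set0)] `&`
    ([set t | edist q' (z t) < a - e] `&`
    ([set t | edist q' (y t) < b - e] `&`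
     [set t | edist q' (u t) < c - e]))); last first.
    by apply/seteqP; split => t /=; [move=> []|move=> [? [? []]]].
  apply: measurableI.
    apply: measurable_not.
    have mB : measurable [set x | edist x q' < e].
      by apply: measurable_edist_lt; [exact: measurable_id|exact: measurable_cst].
    rewrite -[X in measurable X]setTI.
    exact: (mF measurableT (measurable_void_event mB (ebounded_open_ball q' e))).
  by apply: measurableI; [|apply: measurableI];
     apply: measurable_edist_lt => //; exact: measurable_cst.
apply/seteqP; split => t.
  move=> [x [Fx xz xy xu]].
  (* [s] is the room left by the point found; a centre [q] closer than [s / 2]
     to it loses at most that room. *)
  pose s := Num.min (a - edist x (z t)) (Num.min (b - edist x (y t)) (c - edist x (u t))).
  have : 0 < s / 2 by rewrite divr_gt0// !lt_min !subr_gt0 xz xy xu.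
  move/ltr_add_invr => [j]; rewrite add0r => js.
  have [q xq] := @rational_point_dense R d x j.+1%:R^-1 ltac:(by rewrite invr_gt0).
  have h w r : s <= r - edist x w -> edist (rational_point q) w < r - j.+1%:R^-1.
    move=> sr; rewrite (le_lt_trans (euclidean_triangle x _ _))// edistC.
    by move: xq js sr; move: (j.+1%:R^-1) (edist x _) => e D; lra.
  exists (q, j); split => /=; [|by apply: h; rewrite /s !ge_min lexx ?orbT..].
  by move=> /seteqP[+ _] => /(_ x); apply.
move=> [[q j] [/= /eqP/set0P[x [Fx xq]] zq yq uq]]; exists x; split => //.
- rewrite (le_lt_trans (euclidean_triangle (rational_point q) _ _))//.
  by move: xq zq => /=; move: (j.+1%:R^-1) => e; lra.
- rewrite (le_lt_trans (euclidean_triangle (rational_point q) _ _))//.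
  by move: xq yq => /=; move: (j.+1%:R^-1) => e; lra.
- rewrite (le_lt_trans (euclidean_triangle (rational_point q) _ _))//.
  by move: xq uq => /=; move: (j.+1%:R^-1) => e; lra.
Qed.

Lemma measurable_hits (z : T -> Rd) (a : R) : measurable_fun setT z ->
  measurable [set t | hits (F t) (z t) a].
Proof.
move=> mz; have := measurable_hits3 a a a mz mz mz; congr (measurable _).
by apply/seteqP; split => t [x]; [move=> []|move=> [? ?]]; exists x.
Qed.

End measurable_hits.

(** The locations [z], [y] and [u] share a cell. At scale [1 / (n + 1)] the
    distances from the nucleus to them are rounded down to [k], [l] and [m], and no
    point is closer than that. This form involves countably many balls, hence is
    measurable; [approx_common_cellP] relates it to the geometric one. *)
Definition approx_common_cell phi z y u := forall n : nat,
  exists klm : nat * nat * nat,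
  let s k := k%:R / n.+1%:R : R in
  [/\ hits3 phi z y u (s klm.1.1.+1) (s klm.1.2.+1) (s klm.2.+1),
      ~ hits phi z (s klm.1.1), ~ hits phi y (s klm.1.2) & ~ hits phi u (s klm.2)].

Lemma measurable_approx_common_cell dT (T : measurableType dT)
    (F : T -> configuration) (z y u : T -> Rd) :
  measurable_fun setT F ->
  measurable_fun setT z -> measurable_fun setT y -> measurable_fun setT u ->
  measurable [set t | approx_common_cell (F t) (z t) (y t) (u t)].
Proof.
move=> mF mz my mu; apply: measurable_forall_nat => n.
apply: measurable_exists => [|[[k l] m]/=]; first exact: countableP.
rewrite (_ : [set t | _] =
    [set t | hits3 (F t) (z t) (y t) (u t) (k.+1%:R / n.+1%:R) (l.+1%:R / n.+1%:R)
               (m.+1%:R / n.+1%:R)] `&`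
    ([set t | ~ hits (F t) (z t) (k%:R / n.+1%:R)] `&`
    ([set t | ~ hits (F t) (y t) (l%:R / n.+1%:R)] `&`
     [set t | ~ hits (F t) (u t) (m%:R / n.+1%:R)]))); last first.
  by apply/seteqP; split => t /=; [move=> []|move=> [? [? []]]].
apply: measurableI; first exact: measurable_hits3.
by apply: measurableI; [|apply: measurableI]; apply: measurable_not;
  exact: measurable_hits.
Qed.

Definition locally_finite phi := forall B, ebounded B -> finite_set (phi `&` B).

(** Compactness: only finitely many points of the configuration can satisfy
    [good 0], so the nonempty decreasing conditions [good n] have a common witness. *)
Lemma locally_finite_limit phi (good : nat -> Rd -> Prop) z (M : R) :
  locally_finite phi ->
  (forall n x, good n x -> phi x) ->
  (forall n m x, (m <= n)%N -> good n x -> good m x) ->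
  (forall x, good 0 x -> edist x z < M) ->
  (forall n, exists x, good n x) -> exists x, forall n, good n x.
Proof.
move=> lf good_phi goodW good_ball exgood.
have /lf/finite_seqP[s sE] := ebounded_open_ball z M.
have good_s n x : good n x -> x \in s.
  move=> gx; suff : [set` s] x by [].
  by rewrite -sE; split; [exact: good_phi gx|exact/good_ball/(goodW n)].
apply: contrapT => nogood.
have ex x : exists n, ~ good n x.
  apply: contrapT => hn; apply: nogood; exists x => n.
  by apply: contrapT => ng; apply: hn; exists n.
(* At the largest index where some candidate fails, none is left. *)
pose N x := projT1 (cid (ex x)).
have [x gx] := exgood (\max_(x <- s) N x)%N.
have := projT2 (cid (ex x)); apply; apply: (goodW _ _ _ _ gx).
by apply: (leq_bigmax_seq x) => //; exact: good_s gx.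
Qed.

Definition almost_nearest phi z (n : nat) x :=
  forall x', phi x' -> edist x z < edist x' z + n.+1%:R^-1.

Lemma almost_nearest_le phi z n m x : (m <= n)%N ->
  almost_nearest phi z n x -> almost_nearest phi z m x.
Proof.
move=> mn h x' /h/lt_le_trans; apply; rewrite lerD2l lef_pV2 ?posrE//.
by rewrite ler_nat.
Qed.

Lemma nearest_limit phi z x :
  (forall n, almost_nearest phi z n x) -> voronoi_cell phi x z.
Proof.
move=> h x' px'; rewrite leNgt; apply/negP => /ltr_add_invr[n].
by rewrite ltNge => /negP; apply; rewrite edistC; apply/ltW/h.
Qed.

(** Each [n] yields a point that is nearest to the three locations up to
    [1 / (n + 1)]; local finiteness makes it the same point for all [n]. *)
Lemma approx_common_cellP phi z y u : locally_finite phi ->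
  approx_common_cell phi z y u <->
  exists x, [/\ phi x, voronoi_cell phi x z, voronoi_cell phi x y &
                voronoi_cell phi x u].
Proof.
move=> lf; split => [happ|[x [px xz xy xu]] n]; last first.
  have n0 : 0 < n.+1%:R :> R by [].
  (* [k] is the distance to [x] in units of [1 / (n + 1)], rounded down. *)
  pose k w := Num.trunc (edist x w * n.+1%:R).
  have kP w : ((k w)%:R / n.+1%:R <= edist x w < (k w).+1%:R / n.+1%:R).
    by rewrite ler_pdivrMr// ltr_pdivlMr// truncn_itv// mulr_ge0 ?edist_ge0.
  have kn w : voronoi_cell phi x w -> ~ hits phi w ((k w)%:R / n.+1%:R).
    move=> xw [x' [px' x'w]]; have /andP[kw _] := kP w.
    by have := xw _ px'; rewrite edistC leNgt (lt_le_trans x'w kw).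
  exists ((k z, k y), k u); split; [|exact: kn..].
  by exists x; split => //; [have /andP[] := kP z|have /andP[] := kP y|have /andP[] := kP u].
pose good n x := [/\ phi x, almost_nearest phi z n x, almost_nearest phi y n x
                   & almost_nearest phi u n x].
have near w n (k : nat) x : edist x w < k.+1%:R / n.+1%:R ->
    ~ hits phi w (k%:R / n.+1%:R) -> almost_nearest phi w n x.
  move=> xk nk x' px'; rewrite ltNge; apply/negP => x'x; apply: nk.
  exists x'; split => //; rewrite -(ltrD2r n.+1%:R^-1).
  by rewrite (le_lt_trans x'x)// -[X in _ + X]mul1r -mulrDl natr1.
have exgood n : exists x, good n x.
  have [[[k l] m] [[x [px xz xy xu]] nz ny nu]] := happ n.
  by exists x; split; [|exact: near xz nz|exact: near xy ny|exact: near xu nu].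
have goodW n m x : (m <= n)%N -> good n x -> good m x.
  by move=> mn [px hz hy hu]; split => //; exact: almost_nearest_le mn _.
have [x0 [px0 _ _ _]] := exgood 0%N.
have [||||x gx] := @locally_finite_limit phi good z (edist x0 z + 1) lf.
- by move=> n x [].
- by move=> n; exact: goodW.
- by move=> x [_ hz _ _]; have := hz _ px0; rewrite invr1.
- exact: exgood.
exists x; split; first by have [] := gx 0%N.
- by apply: nearest_limit => n; have [] := gx n.
- by apply: nearest_limit => n; have [] := gx n.
- by apply: nearest_limit => n; have [] := gx n.
Qed.

(** Closed balls are seen through the open balls that decrease to them. *)
Definition near_within phi u (r : R) := forall n, hits phi u (r + n.+1%:R^-1).

Lemma near_withinP phi u r : locally_finite phi ->
  near_within phi u r <-> exists x, phi x /\ edist x u <= r.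
Proof.
move=> lf; split=> [h|[x [px xu]] n]; last first.
  by exists x; split => //; rewrite (le_lt_trans xu)// ltrDl invr_gt0.
have [||||x gx] := @locally_finite_limit phi
    (fun n x => phi x /\ edist x u < r + n.+1%:R^-1) u (r + 1) lf.
- by move=> n x [].
- move=> n m x mn [px xu]; split => //; apply: lt_le_trans xu _.
  by rewrite lerD2l lef_pV2 ?posrE// ler_nat.
- by move=> x []; rewrite invr1.
- exact: h.
exists x; split; first by have [] := gx 0%N.
rewrite leNgt; apply/negP => /ltr_add_invr[n]; have [_ xn] := gx n.
by move=> /(lt_trans xn); rewrite ltxx.
Qed.

Lemma measurable_near_within dT (T : measurableType dT) (F : T -> configuration)
    (u : T -> Rd) r : measurable_fun setT F -> measurable_fun setT u ->
  measurable [set t | near_within (F t) (u t) r].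
Proof.
by move=> mF mu; apply: measurable_forall_nat => n; exact: measurable_hits.
Qed.

End configurations.

(** * The density of the transport *)

Section cell_density.
Context {R : realType} {d : nat}.
Local Notation Rd := (d.-tuple R).
Implicit Types (phi : set Rd) (x y z u v : Rd) (B : set Rd).

Definition shared_volume phi z y : \bar R :=
  lebesgue_tuple d [set u | approx_common_cell phi z y u].

(** The density at [y] of a uniform point of the cell that contains [z]. The
    normalisation is the volume of the region sharing a nucleus with both [z] and
    [y], instead of the volume of the cell of [z]: the two agree outside
    cell boundaries, and this one is symmetric in [z] and [y] everywhere. *)
Definition cell_density phi z y : R :=
  `[< approx_common_cell phi z y y >]%:R / fine (shared_volume phi z y).

Lemma cell_density_ge0 phi z y : 0 <= cell_density phi z y.
Proof. by rewrite mulr_ge0// invr_ge0 fine_ge0// measure_ge0. Qed.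

Lemma cell_densityC phi z y : cell_density phi z y = cell_density phi y z.
Proof.
have hC a b c w : hits3 phi z y w a b c -> hits3 phi y z w b a c.
  by move=> [x [? ? ? ?]]; exists x.
have swap_yz w : approx_common_cell phi z y w <-> approx_common_cell phi y z w.
  by split => h n; have [[[k l] m] [[x [? ? ? ?]] ? ? ?]] := h n;
    exists ((l, k), m); split => //; exists x.
have swap_last z' y' : approx_common_cell phi z' y' y' -> approx_common_cell phi y' z' z'.
  by move=> h n; have [[[k l] m] [[x [? ? ? ?]] ? ? ?]] := h n;
    exists ((l, k), k); split => //; exists x.
congr (_%:R / fine _).
  by congr (nat_of_bool _); apply: asbool_equiv_eq; split; exact: swap_last.
by congr (lebesgue_tuple d _); apply/seteqP; split => w /swap_yz.
Qed.

Section measurability_of_density.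
Context {dT : measure_display} {T : measurableType dT}.
Variables (F : T -> @configuration R d) (z y : T -> Rd).
Hypotheses (mF : measurable_fun setT F).
Hypotheses (mz : measurable_fun setT z) (my : measurable_fun setT y).

Lemma measurable_shared_volume :
  measurable_fun setT (fun t => shared_volume (F t) (z t) (y t)).
Proof.
pose A := [set p : T * Rd | approx_common_cell (F p.1) (z p.1) (y p.1) p.2].
have mA : measurable A.
  apply: measurable_approx_common_cell; last exact: measurable_snd.
  - exact: (measurableT_comp mF measurable_fst).
  - exact: (measurableT_comp mz measurable_fst).
  - exact: (measurableT_comp my measurable_fst).
have := measurable_fun_xsection (lebesgue_tuple d) mA.
apply: eq_measurable_fun => t _ /=; congr (lebesgue_tuple d _).
by apply/seteqP; split => u; rewrite /xsection /= inE.
Qed.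

Lemma measurable_cell_density :
  measurable_fun setT (fun t => cell_density (F t) (z t) (y t)).
Proof.
have powV (x : \bar R) : (0 <= x)%E -> (fine x)^-1 = fine x `^ (-1).
  by move=> x0; rewrite powR_inv1 ?fine_ge0.
apply: measurable_funM.
  apply: (measurableT_comp (f := fun b : bool => b%:R : R)) => //.
  apply: (@measurable_fun_bool _ _ _ _ true); rewrite setTI.
  have := measurable_approx_common_cell mF mz my my; congr (measurable _).
  by apply/seteqP; split => t /asboolP.
rewrite (_ : (fun t => _) =
    (fun r : R => r `^ (-1)) \o (fun t => fine (shared_volume (F t) (z t) (y t)))).
  apply: measurableT_comp; first exact: measurable_powR.
  by apply: measurableT_comp measurable_shared_volume; exact: fine_measurable.
by apply/funext => t /=; rewrite powV// measure_ge0.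
Qed.

End measurability_of_density.

(** The configuration moved by [- v]. *)
Definition shift v phi : set Rd := [set x | phi (affine 1 v x)].

Lemma shift_hits3 v phi z y u a b c : hits3 (shift v phi) z y u a b c <->
  hits3 phi (affine 1 v z) (affine 1 v y) (affine 1 v u) a b c.
Proof.
split=> [[x [px xz xy xu]]|[x [px xz xy xu]]].
  by exists (affine 1 v x); rewrite !edist_affine normr1 !mul1r.
have [x' x'E] : exists x', x = affine 1 v x'.
  exists [tuple tnth x i - tnth v i | i < d].
  by apply: eq_from_tnth => i; rewrite !tnth_mktuple; ring.
move: px xz xy xu; rewrite x'E !edist_affine normr1 !mul1r => px xz xy xu.
by exists x'.
Qed.

Lemma hitsE phi z a : hits phi z a <-> hits3 phi z z z a a a.
Proof. by split=> [[x []]|[x []]]; exists x. Qed.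

Lemma shift_hits v phi z a : hits (shift v phi) z a <-> hits phi (affine 1 v z) a.
Proof. by rewrite !hitsE; exact: shift_hits3. Qed.

Lemma shift_approx_common_cell v phi z y u :
  approx_common_cell (shift v phi) z y u <->
  approx_common_cell phi (affine 1 v z) (affine 1 v y) (affine 1 v u).
Proof.
have e3 a b c := propext (shift_hits3 v phi z y u a b c).
have e1 w a := propext (shift_hits v phi w a).
by split=> h n; have [klm h'] := h n; exists klm; move: h'; rewrite /= !e3 !e1.
Qed.

Lemma shift_cell_density v phi z y :
  cell_density (shift v phi) z y =
  cell_density phi (affine 1 v z) (affine 1 v y).
Proof.
congr (_%:R / fine _).
  by congr (nat_of_bool _); apply: asbool_equiv_eq; exact: shift_approx_common_cell.
rewrite /shared_volume -[RHS](@lebesgue_tuple_affine R d 1 v) ?oner_neq0//; last first.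
  have := @measurable_approx_common_cell R d _ Rd (cst phi)
    (cst (affine 1 v z)) (cst (affine 1 v y)) id.
  by apply; try exact: measurable_cst; exact: measurable_id.
rewrite normr1 expr1n mul1e; congr (lebesgue_tuple d _).
by apply/seteqP; split => u /=; rewrite (propext (shift_approx_common_cell v phi z y u)).
Qed.

End cell_density.

(** * Void probabilities and shells *)

Section counting_small.
Context {R : realType} {T : choiceType}.
Implicit Types X : set T.

Let counting_mem X k x : counting X = k%:R%:E :> \bar R -> X x ->
  exists s : seq T, [/\ size s = k & forall y, X y -> y \in s].
Proof.
rewrite /counting; case: ifPn => [/asboolP fX|//] [] /eqP; rewrite eqr_nat => /eqP sk Xx.
exists (finmap.enum_fset (fset_set X)); split => // y Xy.
by have := in_fset_set fX y; rewrite (mem_set Xy).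
Qed.

Lemma counting_eq0 X : counting X = 0%:R%:E :> \bar R <-> X = set0.
Proof.
split=> [X0|->]; last first.
  rewrite /counting ifT ?fset_set0//; exact/asboolP.
apply/seteqP; split => // x Xx; have [s [s0 /(_ _ Xx)]] := counting_mem X0 Xx.
by move: s0 => /eqP/nilP ->.
Qed.

Lemma counting_eq1 X x y : counting X = 1%:R%:E :> \bar R -> X x -> X y -> x = y.
Proof.
move=> X1 Xx Xy; have [s [s1 sX]] := counting_mem X1 Xx.
move: (sX _ Xx) (sX _ Xy); case: s s1 {sX} => [//|a [|//]] _.
by rewrite !inE => /eqP -> /eqP ->.
Qed.

End counting_small.

Section shells.
Context {R : realType} {d : nat}.
Hypothesis d_gt0 : (0 < d)%N.

Lemma ebounded_closed_ball r : ebounded (@closed_ball_at_origin R d r).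
Proof. by exists r. Qed.

(** The bounds are on the [d]-th power of the norm, which makes the volume linear
    in them. *)
Definition shell (a b : R) : set (d.-tuple R) :=
  [set x | a < edist origin x ^+ d <= b].

Let radius (s : R) := s `^ (d%:R^-1).

Let radiusX s : 0 <= s -> radius s ^+ d = s.
Proof.
move=> s0; rewrite -powR_mulrn ?powR_ge0// -powRrM mulVf ?powRr1//.
by rewrite pnatr_eq0 -lt0n.
Qed.

Let le_radius s (x : d.-tuple R) : 0 <= s ->
  (edist origin x <= radius s) = (edist origin x ^+ d <= s).
Proof.
by move=> s0; rewrite -{2}(radiusX s0) ler_pXn2r// nnegrE ?edist_ge0 ?powR_ge0.
Qed.

Let shellE a b : 0 <= a -> 0 <= b ->
  shell a b = closed_ball_at_origin (radius b) `\` closed_ball_at_origin (radius a).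
Proof.
move=> a0 b0; apply/seteqP; split => x; rewrite /shell /closed_ball_at_origin /=.
  by move=> /andP[xa xb]; rewrite !le_radius//; split => //; apply/negP; rewrite -ltNge.
by rewrite !le_radius// => -[-> /negP]; rewrite -ltNge => ->.
Qed.

Lemma measurable_shell a b : 0 <= a -> 0 <= b -> measurable (shell a b).
Proof.
by move=> a0 b0; rewrite shellE//; apply: measurableD;
  exact: measurable_closed_ball_at_origin.
Qed.

Lemma ebounded_shell a b : 0 <= a -> 0 <= b -> ebounded (shell a b).
Proof.
move=> a0 b0; exists (radius b) => x; rewrite shellE// => -[] //.
Qed.

Lemma lebesgue_tuple_shell a b : 0 <= a -> a <= b ->
  lebesgue_tuple d (shell a b) = (kappa d * (b - a))%:E.
Proof.
move=> a0 ab; have b0 := le_trans a0 ab.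
have sub : @closed_ball_at_origin R d (radius a) `<=` closed_ball_at_origin (radius b).
  by move=> x; rewrite /closed_ball_at_origin /= !le_radius// => /le_trans; exact.
have mB := @measurable_closed_ball_at_origin R d.
have V c : 0 <= c ->
    lebesgue_tuple d (@closed_ball_at_origin R d (radius c)) = (kappa d * c)%:E.
  by move=> c0; rewrite lebesgue_tuple_closed_ball// ?powR_ge0// radiusX.
have fin_b : (lebesgue_tuple d (@closed_ball_at_origin R d (radius b)) < +oo)%E.
  by rewrite V// ltry.
pose ball s := @closed_ball_at_origin R d (radius s).
have D : (lebesgue_tuple d (ball b `\` ball a) =
    lebesgue_tuple d (ball b) - lebesgue_tuple d (ball b `&` ball a))%E.
  exact: measureD (mB _) (mB _) fin_b.
by rewrite shellE// D setIidr// /ball !V// -EFinB -mulrBr.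
Qed.

End shells.

Section poisson_facts.
Context {dO : measure_display} {Omega : measurableType dO} {R : realType} {d : nat}.
Variables (P : probability Omega R) (lambda : R) (Phi : Omega -> set (d.-tuple R)).
Hypotheses (Phi_poisson : poisson_process P lambda Phi).
Local Notation Rd := (d.-tuple R).

Lemma npoints_eq0 B w : npoints Phi B w = 0%:R%:E <-> Phi w `&` B = set0.
Proof. exact: counting_eq0. Qed.

Let void_eventE B : [set w | Phi w `&` B = set0] = npoints Phi B @^-1` [set 0%E].
Proof. by apply/seteqP; split => w /= /npoints_eq0. Qed.

Lemma void_probability B : measurable B -> ebounded B ->
  P [set w | Phi w `&` B = set0] =
  (expR (- (lambda * fine (lebesgue_tuple d B))))%:E.
Proof.
move=> mB bB; have := pp_poisson Phi_poisson mB bB 0.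
rewrite /= fact0 expr0 divr1 mul1r => <-; congr (P _).
by apply/seteqP; split => w /= /npoints_eq0.
Qed.

Lemma measurable_process :
  measurable_fun setT (Phi : Omega -> @configuration R d).
Proof.
apply: (@measurability _ _ Omega (@configuration R d) setT Phi void_events) => //.
move=> _ [_ [B [mB bB ->]] <-].
rewrite setTI [X in measurable X]void_eventE -[X in measurable X]setTI.
by apply: (pp_measurable Phi_poisson mB).
Qed.

(** Conditioning on the events of the process includes conditioning on those that
    void events generate. *)
Lemma sigma_process_preimage (E : set (@configuration R d)) : measurable E ->
  sigma_process Phi (Phi @^-1` E).
Proof.
move: E; apply: (@smallest_sub _ _ _ [set E | sigma_process Phi (Phi @^-1` E)]).
  have [s0 sC sU] : sigma_algebra setT (sigma_process Phi).
    exact: smallest_sigma_algebra.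
  split => /=.
  - by rewrite preimage_set0.
  - by move=> A /sC; rewrite !setTD preimage_setC.
  - by move=> A /sU; rewrite preimage_bigcup.
move=> _ [B [mB bB ->]] /=; apply: sub_sigma_algebra; exists B, [set 0%E].
by split => //; rewrite -void_eventE.
Qed.

End poisson_facts.

(** * Stationarity *)

Section stationarity.
Context {dO : measure_display} {Omega : measurableType dO} {R : realType} {d : nat}.
Variables (P : probability Omega R) (lambda : R) (Phi : Omega -> set (d.-tuple R)).
Hypotheses (Phi_poisson : poisson_process P lambda Phi).
Local Notation Rd := (d.-tuple R).
Local Notation conf := (@configuration R d).

Let translateK (v x : Rd) :
  affine 1 v (affine 1 [tuple - tnth v i | i < d] x) = x.
Proof. by apply: eq_from_tnth => i; rewrite !tnth_mktuple; ring. Qed.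

Let translateNK (v x : Rd) :
  affine 1 [tuple - tnth v i | i < d] (affine 1 v x) = x.
Proof. by apply: eq_from_tnth => i; rewrite !tnth_mktuple; ring. Qed.

Section void_shift.
Variables (v : Rd) (B : set Rd).
Hypotheses (mB : measurable B) (bB : ebounded B).

Let B' := affine 1 [tuple - tnth v i | i < d] @^-1` B.

Lemma shift_void (phi : set Rd) : shift v phi `&` B = set0 <-> phi `&` B' = set0.
Proof.
split=> /seteqP[h _]; apply/seteqP; split => // x [px Bx].
  apply: (h (affine 1 [tuple - tnth v i | i < d] x)); split => //.
  by rewrite /shift /= translateK.
by apply: (h (affine 1 v x)); split => //; rewrite /B' /= translateNK.
Qed.

Lemma measurable_translate : measurable B'.
Proof. by rewrite -[X in measurable X]setTI; exact: measurable_affine. Qed.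

Lemma ebounded_translate : ebounded B'.
Proof.
case: bB => M BM; exists (edist origin (affine 1 v origin) + M) => x /BM xM.
rewrite (le_trans (euclidean_triangle (affine 1 v origin) _ _))// lerD2l.
by rewrite -[x in leLHS](translateK v) edist_affine normr1 mul1r.
Qed.

Lemma lebesgue_tuple_translate : lebesgue_tuple d B' = lebesgue_tuple d B.
Proof.
rewrite -[RHS](@lebesgue_tuple_affine R d 1 [tuple - tnth v i | i < d])//.
  by rewrite normr1 expr1n mul1e.
Qed.

End void_shift.

Lemma measurable_shift v : measurable_fun setT (shift v : conf -> conf).
Proof.
apply: (@measurability _ _ conf conf setT _ void_events) => // _ [_ [B [mB bB ->]] <-].
rewrite setTI; apply: sub_sigma_algebra.
exists (affine 1 [tuple - tnth v i | i < d] @^-1` B); split.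
- exact: measurable_translate.
- exact: ebounded_translate.
- by apply/seteqP; split => phi /=; rewrite (propext (shift_void v B phi)).
Qed.

Let law (v : Rd) : {measure set conf -> \bar R}.
Proof.
refine (pushforward P (fun w => shift v (Phi w) : conf)).
apply: (measurableT_comp (measurable_shift v)).
exact: (measurable_process Phi_poisson).
Defined.

Let shift0 (phi : set Rd) : shift origin phi = phi.
Proof.
rewrite /shift; apply/seteqP; split => x /=; rewrite (_ : affine 1 origin x = x)//;
  by apply: eq_from_tnth => i; rewrite !tnth_mktuple; ring.
Qed.

(** A translate of the process has the same void probabilities, and these
    determine the law on the sigma-algebra that the void events generate. *)
Lemma stationary_law v (A : set conf) : measurable A ->
  P [set w | A (shift v (Phi w))] = P [set w | A (Phi w)].
Proof.
move=> mA; have -> : [set w | A (Phi w)] = [set w | A (shift origin (Phi w))].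
  by apply/seteqP; split => w /=; rewrite shift0.
rewrite -[LHS]/(law v A) -[RHS]/(law origin A).
apply: (@measure_unique _ R conf void_events (fun=> setT) _ _ _ _ (law v) (law origin)) => //.
- move=> _ _ [B [mB bB ->]] [C [mC bC ->]]; exists (B `|` C); split.
  + exact: measurableU.
  + case: bB bC => [M BM] [N CN]; exists (Num.max M N) => x [/BM|/CN] h;
      by rewrite le_max h ?orbT.
  + by apply/seteqP; split => phi; rewrite /= setIUr setU_eq0.
- move=> _; exists set0; split; [exact: measurable0|by exists 0 => x|].
  by apply/seteqP; split => phi //= _; rewrite setI0.
- by rewrite bigcup_const.
- move=> _ [B [mB bB ->]].
  have E u : law u [set phi | phi `&` B = set0] =
      (expR (- (lambda * fine (lebesgue_tuple d B))))%:E.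
    rewrite -(lebesgue_tuple_translate u mB) -(void_probability Phi_poisson).
    - by congr (P _); apply/seteqP; split => w /=; rewrite (propext (shift_void u B (Phi w))).
    - exact: measurable_translate.
    - exact: ebounded_translate.
  by rewrite !E.
- by move=> _; rewrite /= /pushforward preimage_setT probability_setT ltry.
Qed.

Lemma stationary_expectation v (f : conf -> \bar R) :
  measurable_fun setT f -> (forall phi, 0 <= f phi)%E ->
  (\int[P]_w f (shift v (Phi w)) = \int[P]_w f (Phi w))%E.
Proof.
move=> mf f0; have mPhi := measurable_process Phi_poisson.
have mS := measurableT_comp (measurable_shift v) mPhi.
have := @ge0_integral_pushforward _ _ _ _ R _ mPhi P setT f measurableT mf (fun x _ => f0 x).
have := @ge0_integral_pushforward _ _ _ _ R _ mS P setT f measurableT mf (fun x _ => f0 x).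
rewrite !preimage_setT => <- <-.
by apply: eq_measure_integral => A mA _; exact: stationary_law.
Qed.

End stationarity.

(** * Uniqueness of the nucleus of the origin *)

Section ties.
Context {dO : measure_display} {Omega : measurableType dO} {R : realType} {d : nat}.
Variables (P : probability Omega R) (lambda : R) (Phi : Omega -> set (d.-tuple R)).
Hypotheses (d_gt0 : (0 < d)%N) (lambda_gt0 : 0 < lambda).
Hypotheses (Phi_poisson : poisson_process P lambda Phi).
Local Notation Rd := (d.-tuple R).

Definition crowded (B : set Rd) : set Omega :=
  [set w | npoints Phi B w <> 0%:R%:E /\ npoints Phi B w <> 1%:R%:E].

Let measurable_npoints_eq (B : set Rd) (k : nat) : measurable B ->
  measurable [set w | npoints Phi B w = k%:R%:E].
Proof.
move=> mB; have -> : [set w | npoints Phi B w = k%:R%:E] =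
    npoints Phi B @^-1` [set k%:R%:E] by [].
by rewrite -[X in measurable X]setTI; apply: (pp_measurable Phi_poisson mB).
Qed.

Let crowdedE B : crowded B =
  ~` ([set w | npoints Phi B w = 0%:R%:E] `|` [set w | npoints Phi B w = 1%:R%:E]).
Proof. by apply/seteqP; split => w /=; [move=> [? ?] []|move=> /not_orP]. Qed.

Lemma measurable_crowded B : measurable B -> measurable (crowded B).
Proof.
by move=> mB; rewrite crowdedE; apply: measurableC; apply: measurableU;
  exact: measurable_npoints_eq.
Qed.

(** As [1 - m <= exp (- m)], the probability [1 - exp (- m) (1 + m)] is at most
    [1 - (1 - m) (1 + m) = m ^ 2]. *)
Lemma crowded_probability B : measurable B -> ebounded B ->
  (P (crowded B) <= ((lambda * fine (lebesgue_tuple d B)) ^+ 2)%:E)%E.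
Proof.
move=> mB bB; set m := lambda * _.
have m0 : 0 <= m by rewrite mulr_ge0 ?fine_ge0 ?measure_ge0// ltW.
have P0 := pp_poisson Phi_poisson mB bB 0.
have P1 := pp_poisson Phi_poisson mB bB 1.
rewrite crowdedE probability_setC; last first.
  by apply: measurableU; exact: measurable_npoints_eq.
have -> : (P ([set w | npoints Phi B w = 0%:R%:E] `|` [set w | npoints Phi B w = 1%:R%:E]) =
    P [set w | npoints Phi B w = 0%:R%:E] + P [set w | npoints Phi B w = 1%:R%:E])%E.
  apply: measureU; [exact: measurable_npoints_eq..|].
  apply/seteqP; split => // w /= [-> /eqP].
  by rewrite eqe eqr_nat.
rewrite P0 P1 -/m /= expr0 expr1 fact0 !divr1 mul1r -EFinD lee_fin.
have := expR_ge1Dx (- m); nra.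
Qed.

(* Two points with the same norm, of [d]-th power in ]0, M], lie in one of the
   [n + 1] shells of equal volume. *)
Let norm_ties (M n : nat) : set Omega := \big[setU/set0]_(k < n.+1)
  crowded (shell (k%:R * (M%:R / n.+1%:R)) (k.+1%:R * (M%:R / n.+1%:R))).

Let shell_bound_ge0 (k M n : nat) : 0 <= k%:R * (M%:R / n.+1%:R) :> R.
Proof. by rewrite mulr_ge0// divr_ge0. Qed.

Let measurable_norm_ties M n : measurable (norm_ties M n).
Proof.
apply: bigsetU_measurable => k _; apply: measurable_crowded.
exact: measurable_shell.
Qed.

Let norm_ties_probability M n :
  (P (norm_ties M n) <= ((lambda * kappa d * M%:R) ^+ 2 / n.+1%:R)%:E)%E.
Proof.
have N0 : n.+1%:R != 0 :> R by rewrite pnatr_eq0.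
pose A (k : nat) := crowded (shell (k%:R * (M%:R / n.+1%:R)) (k.+1%:R * (M%:R / n.+1%:R))).
apply: (le_trans (@Boole_inequality _ _ _ P A n.+1 _)) => [k _|].
  by apply: measurable_crowded; exact: measurable_shell.
apply: (@le_trans _ _ (\sum_(k < n.+1) ((lambda * kappa d * M%:R) ^+ 2 / n.+1%:R ^+ 2)%:E)%E).
  apply: lee_sum => k _.
  apply: (le_trans (crowded_probability _ _)).
  - exact: measurable_shell.
  - exact: ebounded_shell.
  rewrite lebesgue_tuple_shell//; last by rewrite ler_wpM2r ?ler_nat// divr_ge0.
  rewrite lee_fin le_eqVlt; apply/orP; left; apply/eqP.
  rewrite /= -mulrBl -natrB// subSnn mul1r.
  by move: n.+1%:R N0 => N N0; field.
rewrite sumEFin lee_fin sumr_const card_ord -[leLHS]mulr_natr.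
rewrite le_eqVlt; apply/orP; left; apply/eqP.
by move: n.+1%:R N0 => N N0; field.
Qed.

(** The bound of [norm_ties_probability] tends to [0] as [n] grows, so equal norms
    below any [M] have probability [0]. Equal norms [0] are excluded because both
    points would be the origin. *)
Lemma no_ties_at_origin : {ae P, forall w, forall x x', Phi w x -> Phi w x' ->
  edist origin x = edist origin x' -> x = x'}.
Proof.
have null M : P (\bigcap_n norm_ties M n) = 0%E.
  apply/eqP; rewrite eq_le measure_ge0 andbT; apply/lee_addgt0Pr => e e0.
  rewrite add0e; set C := (lambda * kappa d * M%:R) ^+ 2.
  have C0 : 0 <= C by exact: sqr_ge0.
  have : 0 < e / (C + 1) by rewrite divr_gt0// ltr_wpDl.
  move=> /ltr_add_invr[n]; rewrite add0r => hn.
  apply: (@le_trans _ _ (P (norm_ties M n))).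
    apply: le_measure; rewrite ?inE//; first exact: bigcapT_measurable.
    exact: bigcap_inf.
  rewrite (le_trans (norm_ties_probability _ _))// lee_fin -/C.
  have C1 : 0 < C + 1 by rewrite ltr_wpDl.
  move: hn; rewrite ltr_pdivlMr// => hn; apply: le_trans (ltW hn).
  by rewrite mulrC ler_wpM2l// lerDl.
have : P.-negligible (\bigcup_M \bigcap_n norm_ties M n).
  apply: negligible_bigcup => M; exists (\bigcap_n norm_ties M n).
  by split; [exact: bigcapT_measurable|exact: null|].
move=> negl; apply: (negligibleS _ negl) => w /= /existsNP[x /existsNP[x' /not_implyP[px
  /not_implyP[px' /not_implyP[xx' neq]]]]].
have norm_gt0 : 0 < edist origin x ^+ d.
  rewrite exprn_gt0// lt_neqAle edist_ge0 andbT; apply/eqP => x0.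
  by apply: neq; rewrite -(edist_eq0 (esym x0)); apply/edist_eq0; rewrite -xx'.
pose M := (Num.trunc (edist origin x ^+ d)).+1.
have xM : edist origin x ^+ d <= M%:R.
  by have /truncn_itv/andP[_ /ltW] := ltW norm_gt0.
exists M => // n _.
pose c : R := M%:R / n.+1%:R.
have ex : exists j : nat, edist origin x ^+ d <= j%:R * c.
  by exists n.+1; rewrite /c mulrCA divff ?mulr1// pnatr_eq0.
(* The shell is found by the least multiple of [c] that bounds the norm. *)
case: (ex_minnP ex) => -[|k] kx kmin.
  by move: kx; rewrite mul0r leNgt norm_gt0.
have kn : (k < n.+1)%N.
  by apply: kmin; rewrite /c mulrCA divff ?mulr1// pnatr_eq0.
have xk : k%:R * c < edist origin x ^+ d.
  by rewrite ltNge; apply/negP => /kmin; rewrite ltnn.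
have := bigcup_mkord n.+1 (fun k : nat => crowded (shell (k%:R * c) (k.+1%:R * c))).
rewrite /norm_ties -/c => <-; exists k => //.
have in_shell (z : Rd) : edist origin z = edist origin x -> shell (k%:R * c) (k.+1%:R * c) z.
  by move=> zx; rewrite /shell /= zx; apply/andP; split; [exact: xk|exact: kx].
split.
  by move=> /counting_eq0/seteqP[h _]; apply: (h x); split => //; exact: in_shell.
move=> h; apply: neq; apply: (counting_eq1 h); split => //; exact: in_shell.
Qed.

End ties.

(** * The cell of the origin *)

Section untied_cell.
Context {R : realType} {d : nat}.
Local Notation Rd := (d.-tuple R).
Variables (phi : set Rd) (xo : Rd).
Hypotheses (phi_lf : locally_finite phi) (phi_xo : phi xo).
Hypothesis origin_cell : voronoi_cell phi xo origin.
Hypothesis untied : forall x x', phi x -> phi x' ->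
  edist origin x = edist origin x' -> x = x'.

Local Notation V := (voronoi_cell phi xo).

(** A shared nucleus is nearest to the origin, hence is [xo]. *)
Lemma approx_common_cell_origin z u :
  approx_common_cell phi origin z u <-> V z /\ V u.
Proof.
split=> [/(approx_common_cellP _ _ _ phi_lf)[x [px x0 xz xu]]|[Vz Vu]].
  suff <- : x = xo by [].
  apply: untied => //; apply/eqP; rewrite eq_le.
  have := x0 _ phi_xo; have := origin_cell px.
  by rewrite [edist x origin]edistC [edist xo origin]edistC => -> ->.
by apply/approx_common_cellP => //; exists xo.
Qed.

Lemma cell_density_originE u :
  cell_density phi origin u = \1_V u / fine (lebesgue_tuple d V).
Proof.
rewrite /cell_density indicE; have [Vu|nVu] := pselect (V u).
  rewrite mem_set// asboolT; last exact/approx_common_cell_origin.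
  congr (_ / fine (lebesgue_tuple d _)).
  by apply/seteqP; split => z /=; rewrite (propext (approx_common_cell_origin u z)) => // -[].
by rewrite memNset// asboolF ?mul0r// => /approx_common_cell_origin[].
Qed.

Lemma measurable_voronoi_cell : measurable V.
Proof.
have := @measurable_approx_common_cell R d _ Rd (cst phi) (cst origin) id id
  (measurable_cst _) (measurable_cst _) (@measurable_id _ _ _) (@measurable_id _ _ _).
congr (measurable _); apply/seteqP; split => z /=;
  by rewrite (propext (approx_common_cell_origin z z)); tauto.
Qed.

(** When [V] has infinite volume both sides vanish, as [fine +oo = 0] and the
    inverse of [0] is [0]. *)
Lemma integral_cell_density_origin B : measurable B ->
  (\int[lebesgue_tuple d]_(u in B) (cell_density phi origin u)%:E =
   (fine (lebesgue_tuple d (B `&` V)) / fine (lebesgue_tuple d V))%:E)%E.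
Proof.
move=> mB; have mV := measurable_voronoi_cell.
under eq_integral do rewrite cell_density_originE EFinM.
rewrite ge0_integralZr//; last 2 first.
- by apply/measurable_EFinP; apply: measurable_funTS; exact: measurable_indic.
- by rewrite lee_fin invr_ge0 fine_ge0// measure_ge0.
rewrite integral_indic// setIC EFinM.
have [->|Vfin] := eqVneq (lebesgue_tuple d V) +oo%E; first by rewrite /= invr0 !mule0.
rewrite fineK// ge0_fin_numE ?measure_ge0//.
apply: (@le_lt_trans _ _ (lebesgue_tuple d V)); last by rewrite ltey.
by apply: le_measure; rewrite ?inE//; exact: measurableI.
Qed.

End untied_cell.

(** * Measures and integrals up to null sets *)

Section nonmeasurable_integrand.
Local Open Scope ereal_scope.
Context d (T : measurableType d) (R : realType) (mu : {measure set T -> \bar R}).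

Import HBNNSimple.

Let ge0_le_integralT (f g : T -> \bar R) : (forall x, 0 <= f x) ->
  (forall x, f x <= g x) -> \int[mu]_x f x <= \int[mu]_x g x.
Proof.
move=> f0 fg; have g0 x : 0 <= g x by exact: le_trans (fg x).
rewrite !ge0_integralTE//; apply: le_ereal_sup => _ [h hf <-].
by exists h => // x; exact: le_trans (hf x) (fg x).
Qed.

(** The integral is monotone on all nonnegative functions, and [f] is squeezed
    between two measurable functions that agree with [g] outside a null set. *)
Lemma ge0_ae_eq_integral_nonmeasurable (D : set T) (f g : T -> \bar R) :
  measurable D -> measurable_fun D g ->
  (forall x, 0 <= f x) -> (forall x, 0 <= g x) ->
  {ae mu, forall x, f x = g x} ->
  \int[mu]_(x in D) f x = \int[mu]_(x in D) g x.
Proof.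
move=> mD mg f0 g0 [N [mN N0 fgN]].
have fgE x : ~ N x -> f x = g x by move=> nNx; apply: contrapT => h; apply: nNx; exact: fgN.
rewrite integral_mkcond [RHS]integral_mkcond.
have mgD : measurable_fun setT (g \_ D) by exact/(measurable_restrictT _ mD).1.
have gD0 x : 0 <= (g \_ D) x by apply: erestrict_ge0.
have fD0 x : 0 <= (f \_ D) x by apply: erestrict_ge0.
have fgD x : ~ N x -> (f \_ D) x = (g \_ D) x by move=> /fgE h; rewrite !patchE h.
(* [lo <= f <= up], with [f] replaced on [N] by [0] and by [+oo]. *)
pose up x := if x \in N then +oo else (g \_ D) x.
pose lo := (g \_ D) \_ (~` N).
have mNC : measurable (~` N) by exact: measurableC.
have mlo : measurable_fun setT lo.
  by apply/(measurable_restrictT _ mNC).1; exact: measurable_funTS.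
have mup : measurable_fun setT up.
  apply: measurable_fun_ifT => //.
  apply: (@measurable_fun_bool _ _ _ _ true); rewrite setTI.
  by rewrite (_ : _ @^-1` _ = N)//; apply/seteqP; split => x /=; [exact: set_mem|exact: mem_set].
have ae_lo : {ae mu, forall x, [set: T] x -> (g \_ D) x = lo x}.
  exists N; split => // x /= /not_implyP[_ h]; apply: contrapT => nNx; apply: h.
  by rewrite /lo patchE mem_set.
have ae_up : {ae mu, forall x, [set: T] x -> (g \_ D) x = up x}.
  exists N; split => // x /= /not_implyP[_ h]; apply: contrapT => nNx; apply: h.
  by rewrite /up memNset.
apply/eqP; rewrite eq_le; apply/andP; split.
  rewrite [leRHS](@ge0_ae_eq_integral _ _ _ mu setT _ up)//.
    apply: ge0_le_integralT => // x; rewrite /up; case: ifPn => [_|]; first exact: leey.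
    by rewrite notin_setE => /fgD ->.
  by move=> x _; rewrite /up; case: ifPn => // _; exact: leey.
rewrite [leLHS](@ge0_ae_eq_integral _ _ _ mu setT _ lo)//.
  apply: ge0_le_integralT => x; rewrite /lo patchE; case: ifPn => // /set_mem nNx.
  by rewrite fgD.
by move=> x _; rewrite /lo patchE; case: ifPn.
Qed.

End nonmeasurable_integrand.

Section weighted_image.
Local Open Scope ereal_scope.
Context d1 d2 (T1 : measurableType d1) (T2 : measurableType d2) (R : realType).
Variables (mu : {measure set T1 -> \bar R}) (f : T1 -> T2) (K : T1 -> \bar R).
Hypotheses (mf : measurable_fun setT f) (mK : measurable_fun setT K).
Hypothesis K0 : forall x, 0 <= K x.

Definition weighted_image (A : set T2) : \bar R := \int[mu]_(x in f @^-1` A) K x.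

Let weighted_image0 : weighted_image set0 = 0.
Proof. by rewrite /weighted_image preimage_set0 integral_set0. Qed.

Let weighted_image_ge0 A : 0 <= weighted_image A.
Proof. exact: integral_ge0. Qed.

Let weighted_image_sigma_additive : semi_sigma_additive weighted_image.
Proof.
move=> F mF tF mUF; rewrite /weighted_image preimage_bigcup; apply: cvg_toP.
  apply: ereal_nondecreasing_is_cvgn => m n mn.
  by apply: lee_sum_nneg_natr => // k _ _; exact: integral_ge0.
rewrite ge0_integral_bigcup//=.
- by move=> k; rewrite -[X in measurable X]setTI; exact: mf.
- exact: measurable_funTS.
- apply/trivIsetP => i j _ _ ij; rewrite -preimage_setI.
  by move/trivIsetP : tF => /(_ i j I I ij) ->; rewrite preimage_set0.
Qed.

HB.instance Definition _ := isMeasure.Build _ _ _ weighted_image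
  weighted_image0 weighted_image_ge0 weighted_image_sigma_additive.

End weighted_image.

Section measures_on_products.
Local Open Scope ereal_scope.
Context d1 d2 (T1 : measurableType d1) (T2 : measurableType d2) (R : realType).
Variables m1 m2 : {measure set (T1 * T2) -> \bar R}.

Lemma eq_finite_measure_rectangles : m1 setT < +oo ->
  (forall A B, measurable A -> measurable B -> m1 (A `*` B) = m2 (A `*` B)) ->
  forall X, measurable X -> m1 X = m2 X.
Proof.
move=> m1fin m12 X mX.
pose C : set (set (T1 * T2)) :=
  [set C | exists A B, [/\ measurable A, measurable B & C = A `*` B]].
apply: (measure_unique C (fun=> setT)) => //.
- rewrite measurable_prod_measurableType; congr (<<s _ >>).
  rewrite predeqE => Y; split => [[A mA [B mB <-]]|[A [B [mA mB ->]]]].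
    by exists A, B.
  by exists A => //; exists B.
- move=> _ _ [A [B [mA mB ->]]] [A' [B' [mA' mB' ->]]].
  by exists (A `&` A'), (B `&` B'); rewrite setXI; split => //; exact: measurableI.
- by move=> _; exists setT, setT; rewrite setXTT.
- by rewrite bigcup_const.
- by move=> _ [A [B [mA mB ->]]]; exact: m12.
Qed.

End measures_on_products.

Section almost_everywhere_probability.
Context d (T : measurableType d) (R : realType) (P : probability T R).

Lemma ae_eq_probability (A B : set T) : measurable A -> measurable B ->
  {ae P, forall w, A w <-> B w} -> P A = P B.
Proof.
move=> mA mB AB.
have E C : measurable C -> P C = (\int[P]_w (\1_C w)%:E)%E.
  by move=> mC; rewrite integral_indic// setIT.
rewrite !E//; apply: ge0_ae_eq_integral => //;
  [by apply/measurable_EFinP; exact: measurable_indic..|].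
by apply: filterS AB => w /propext ABw _; rewrite !indicE /in_mem/= /in_set/= ABw.
Qed.

End almost_everywhere_probability.

(** * The law of the uniform point *)

Section uniform_point.
Context {dO : measure_display} {Omega : measurableType dO} {R : realType} {d : nat}.
Variables (P : probability Omega R) (lambda : R) (Phi : Omega -> set (d.-tuple R)).
Hypotheses (d_gt0 : (0 < d)%N) (lambda_gt0 : 0 < lambda).
Hypotheses (Phi_poisson : poisson_process P lambda Phi).
Local Notation Rd := (d.-tuple R).
Local Notation conf := (@configuration R d).
Local Notation leb := (@lebesgue_tuple R d).
Variables (xo y : {RV P >-> Rd}).
Hypothesis xo_nucleus : zero_cell_nucleus P Phi xo.
Hypothesis y_uniform : conditionally_uniform P Phi
  (fun w => voronoi_cell (Phi w) (xo w)) y.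

Let Phi_lf w : locally_finite (Phi w).
Proof. by move=> B; exact: (pp_locally_finite Phi_poisson). Qed.

Let mPhi : measurable_fun setT (Phi : Omega -> conf).
Proof. exact: measurable_process Phi_poisson. Qed.

Let mPhi1 : measurable_fun setT (fun p : Omega * Rd => Phi p.1 : conf).
Proof. exact: (measurableT_comp mPhi measurable_fst). Qed.

Lemma untied_nucleus : {ae P, forall w, [/\ Phi w (xo w),
  voronoi_cell (Phi w) (xo w) origin &
  forall x x', Phi w x -> Phi w x' -> edist origin x = edist origin x' -> x = x']}.
Proof.
have ties := no_ties_at_origin d_gt0 lambda_gt0 Phi_poisson.
by apply: filterS2 xo_nucleus ties => w [? ?] ?; split.
Qed.

Let K (p : Omega * Rd) : \bar R := (cell_density (Phi p.1) origin p.2)%:E.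

Let K0 p : (0 <= K p)%E.
Proof. by rewrite lee_fin cell_density_ge0. Qed.

Let mK : measurable_fun setT K.
Proof.
apply/measurable_EFinP; exact: measurable_cell_density.
Qed.

Let located (p : Omega * Rd) : conf * Rd := (Phi p.1, p.2).

Let mlocated : measurable_fun setT located.
Proof. by apply/measurable_fun_pairP; split => //; exact: measurable_snd. Qed.

Let sampled (w : Omega) : conf * Rd := (Phi w, y w).

Let msampled : measurable_fun setT sampled.
Proof. by apply/measurable_fun_pairP; split => //; exact: measurable_funPT. Qed.

Let law : {measure set (conf * Rd) -> \bar R}.
Proof. by refine (pushforward P sampled); exact: msampled. Defined.

Let density_law : {measure set (conf * Rd) -> \bar R}.
Proof.
refine (weighted_image (P \x leb)%E located K).
- exact: mlocated.
- exact: mK.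
- exact: K0.
Defined.

Let density_lawE (A : set (conf * Rd)) : measurable A ->
  (density_law A = \int[P]_w \int[leb]_u ((\1_A (located (w, u)))%:E * K (w, u)))%E.
Proof.
move=> mA; rewrite -[LHS]/(\int[P \x leb]_(p in located @^-1` A) K p)%E.
rewrite integral_mkcond.
have mlA : measurable (located @^-1` A).
  by rewrite -[X in measurable X]setTI; exact: mlocated.
rewrite (eq_integral (fun p => (\1_A (located p))%:E * K p)%E); last first.
  move=> p _; rewrite patchE indicE.
  have [Ap|nAp] := pselect (A (located p)); first by rewrite !mem_set// mul1e.
  by rewrite !memNset// mul0e.
rewrite fubini_tonelli1//.
- apply: emeasurable_funM => //; apply/measurable_EFinP.
  by apply: (measurableT_comp (measurable_indic _)).
- by move=> p; rewrite mule_ge0.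
Qed.

(** Both sides are finite measures in [A]. They agree on rectangles because the
    ratio of volumes that defines the conditional law of [y] is almost surely the
    integral of the density. *)
Lemma joint_law (A : set (conf * Rd)) : measurable A ->
  P [set w | A (Phi w, y w)] =
  (\int[P]_w \int[leb]_u
     ((\1_A (Phi w, u))%:E * (cell_density (Phi w) origin u)%:E))%E.
Proof.
move=> mA; rewrite -[RHS](density_lawE mA) -[LHS]/(law A).
apply: eq_finite_measure_rectangles mA.
  by rewrite /= /pushforward preimage_setT probability_setT ltry.
move=> E B mE mB.
rewrite density_lawE; last exact: measurableX.
have mPE : measurable (Phi @^-1` E) by rewrite -[X in measurable X]setTI; exact: mPhi.
have -> : law (E `*` B) = P (Phi @^-1` E `&` y @^-1` B) by [].
rewrite y_uniform//; last exact: sigma_process_preimage.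
pose I w := (\int[leb]_u ((\1_B u)%:E * K (w, u)))%E.
have m1BK : measurable_fun setT (fun p : Omega * Rd => (\1_B p.2)%:E * K p)%E.
  apply: emeasurable_funM => //; apply/measurable_EFinP.
  exact: (measurableT_comp (measurable_indic _) measurable_snd).
have BK0 p : (0 <= (\1_B p.2)%:E * K p)%E by rewrite mule_ge0.
have mI : measurable_fun setT I.
  exact: (@measurable_fun_fubini_tonelli_F _ _ _ _ R leb _ m1BK BK0).
have I0 w : (0 <= I w)%E by apply: integral_ge0 => u _; exact: (BK0 (w, u)).
have IE w : I w = (\int[leb]_(u in B) K (w, u))%E.
  rewrite [RHS]integral_mkcond; apply: eq_integral => u _; rewrite patchE indicE.
  by case: ifPn; rewrite ?mul1e ?mul0e.
rewrite (@ge0_ae_eq_integral_nonmeasurable _ _ _ P _ _ I)//; last 3 first.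
- exact: measurable_funTS.
- by move=> w; rewrite lee_fin mulr_ge0 ?invr_ge0 ?fine_ge0 ?measure_ge0.
- apply: filterS untied_nucleus => w [? ? ?].
  by rewrite IE -(@integral_cell_density_origin _ _ (Phi w) (xo w)).
rewrite integral_mkcond; apply: eq_integral => w _; rewrite patchE.
rewrite (eq_integral (fun u => (\1_E (Phi w))%:E * ((\1_B u)%:E * K (w, u)))%E); last first.
  move=> u _; rewrite muleA; congr (_ * K (w, u))%E.
  by rewrite -EFinM /located !indicE in_setX -natrM mulnb.
rewrite ge0_integralZl//; last 2 first.
- exact: (measurable_fun_pair2 w m1BK).
- by move=> u _; exact: (BK0 (w, u)).
rewrite -/(I w) indicE; have [Ew|nEw] := pselect (E (Phi w)).
  by rewrite !mem_set// mul1e.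
by rewrite !memNset// mul0e.
Qed.

Let total (w : Omega) : \bar R := (\int[leb]_u (cell_density (Phi w) origin u)%:E)%E.

Let mtotal : measurable_fun setT total.
Proof. exact: (@measurable_fun_fubini_tonelli_F _ _ _ _ R leb _ mK K0). Qed.

Let total_ge0 w : (0 <= total w)%E.
Proof. by apply: integral_ge0 => u _; exact: (K0 (w, u)). Qed.

Let integral_total : (\int[P]_w total w = 1)%E.
Proof.
have := joint_law measurableT; rewrite (_ : [set w | _] = setT); last first.
  exact/seteqP.
rewrite probability_setT => ->; apply: eq_integral => w _.
by apply: eq_integral => u _; rewrite indicT mul1e.
Qed.

Let ae_of_probability1 (A : set Omega) : measurable A -> P A = 1%E ->
  {ae P, forall w, A w}.
Proof.
move=> mA PA; exists (~` A); split => //; first exact: measurableC.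
by rewrite probability_setC// PA subee.
Qed.

(** The cell of the origin has finite positive volume: otherwise the ratio of
    volumes would vanish, and could not integrate to the total mass [1]. *)
Lemma total_cell_density : {ae P, forall w, total w = 1%E}.
Proof.
have mA : measurable [set w | total w = 1%E].
  rewrite -[X in measurable X]setTI.
  exact: (mtotal measurableT (emeasurable_set1 1%E)).
apply: ae_of_probability1 => //.
rewrite -[RHS]integral_total.
(* Almost surely [total] only takes the values [0] and [1]. *)
transitivity (\int[P]_w (\1_[set w | total w = 1%E] w)%:E)%E.
  by rewrite integral_indic// setIT.
apply: ge0_ae_eq_integral => //.
  by apply/measurable_EFinP; exact: measurable_indic.
apply: filterS untied_nucleus => w [? ? ?] _.
have := @integral_cell_density_origin _ _ (Phi w) (xo w) (Phi_lf w) _ _ _ setT measurableT.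
rewrite -/(total w) setTI => /(_ _ _ _) tE; rewrite indicE tE//.
set c := fine _; have [c0|c0] := eqVneq c 0.
  rewrite memNset ?c0 ?mul0r//= tE// -/c c0 mul0r => -[] /esym/eqP.
  by rewrite oner_eq0.
by rewrite divff// mem_set//= tE// -/c divff.
Qed.

(** The density vanishes outside the cell of the origin, so the event has the full
    mass of the density. *)
Lemma uniform_point_in_cell :
  {ae P, forall w, approx_common_cell (Phi w) origin (y w) (y w)}.
Proof.
pose A := [set p : conf * Rd | approx_common_cell p.1 origin p.2 p.2].
have mA : measurable A.
  by apply: measurable_approx_common_cell => //; exact: measurable_snd.
apply: ae_of_probability1.
  rewrite -[X in measurable X]setTI; exact: (msampled measurableT mA).
rewrite (joint_law mA) -[RHS]integral_total; apply: eq_integral => w _.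
apply: eq_integral => u _; rewrite indicE.
have [Au|nAu] := pselect (A (Phi w, u)); first by rewrite mem_set// mul1e.
by rewrite /cell_density asboolF// mul0r mule0.
Qed.

Section mass_transport.
Variable r : R.

Let near_origin w : R := \1_[set w : Omega | near_within (Phi w) origin r] w.

Let mnear_origin : measurable [set w : Omega | near_within (Phi w) origin r].
Proof. by apply: measurable_near_within => //; exact: measurable_cst. Qed.

Let shift_near_within (v : Rd) (phi : set Rd) (u : Rd) : near_within (shift v phi) u r <->
  near_within phi (affine 1 v u) r.
Proof. by split=> h n; have := h n; rewrite (propext (shift_hits v phi u _)). Qed.

(** The mass that the origin sends to [u], restricted to [u] within [r] of the
    process, has the same mean as the mass that [- u] sends to the origin,
    restricted to the origin being within [r] of the process. Over all [u] the
    origin receives as much mass as it sends, that is [1]. *)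
Lemma near_uniform_point_probability :
  P [set w | near_within (Phi w) (y w) r] = P [set w | near_within (Phi w) origin r].
Proof.
pose A := [set p : conf * Rd | near_within p.1 p.2 r].
have mA : measurable A by apply: measurable_near_within.
rewrite -[LHS]/(P [set w | A (Phi w, y w)]) (joint_law mA).
(* The mass sent by [- u] to the origin. *)
pose f (u : Rd) (phi : conf) : \bar R :=
  ((\1_[set phi : conf | near_within phi origin r] phi)%:E *
   (cell_density phi (affine (-1) origin u) origin)%:E)%E.
have mN : measurable [set phi : conf | near_within phi origin r].
  by apply: measurable_near_within.
have f0 u phi : (0 <= f u phi)%E by rewrite mule_ge0// lee_fin cell_density_ge0.
have mf u : measurable_fun setT (f u).
  apply: emeasurable_funM; apply/measurable_EFinP; first exact: measurable_indic.
  by apply: measurable_cell_density.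
rewrite (fubini_tonelli (fun p => (\1_A (Phi p.1, p.2))%:E * K p)%E); last 2 first.
- apply: emeasurable_funM => //; apply/measurable_EFinP.
  exact: (measurableT_comp (measurable_indic _) mlocated).
- by move=> p; rewrite mule_ge0.
transitivity (\int[leb]_u \int[P]_w f u (Phi w))%E.
  apply: eq_integral => u _.
  rewrite -(stationary_expectation Phi_poisson u (mf u) (f0 u)).
  apply: eq_integral => w _; rewrite /f shift_cell_density /K/=.
  have -> : affine 1 u (affine (-1) origin u) = origin.
    by apply: eq_from_tnth => i; rewrite !tnth_mktuple; ring.
  have u0 : affine 1 u origin = u.
    by apply: eq_from_tnth => i; rewrite !tnth_mktuple; ring.
  rewrite u0 !indicE; congr ((nat_of_bool _)%:R%:E * _)%E.
  by apply/idP/idP; rewrite !inE /A /= (propext (shift_near_within u (Phi w) origin)) u0.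
pose g (p : Omega * Rd) := f p.2 (Phi p.1).
have mg : measurable_fun setT g.
  apply: emeasurable_funM; apply/measurable_EFinP.
    exact: (measurableT_comp (measurable_indic _) mPhi1).
  apply: measurable_cell_density => //.
  exact: (measurableT_comp (measurable_affine _ _) measurable_snd).
rewrite -(fubini_tonelli g)//; last by move=> p; exact: f0.
have totalE w : (\int[leb]_u (cell_density (Phi w) (affine (-1) origin u) origin)%:E = total w)%E.
  transitivity (\int[leb]_u K (w, affine (-1) origin u))%E.
    by apply: eq_integral => u _; rewrite cell_densityC.
  have := @ge0_integral_lebesgue_tuple_affine R d (-1) origin (fun u => K (w, u)).
  rewrite normrN1 expr1n mul1e; apply=> [||u]; last exact: (K0 (w, u)).
    by rewrite oppr_eq0 oner_eq0.
  exact: (measurable_fun_pair2 w mK).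
transitivity (\int[P]_w (near_origin w)%:E)%E; last by rewrite integral_indic// setIT.
apply: ge0_ae_eq_integral => //.
- exact: (@measurable_fun_fubini_tonelli_F _ _ _ _ R leb g mg (fun p => f0 _ _)).
- by apply/measurable_EFinP; exact: measurable_indic.
- by move=> w _; apply: integral_ge0 => u _; exact: f0.
- by move=> w _; rewrite lee_fin.
apply: filterS total_cell_density => w tw _; rewrite /g /f /=.
rewrite ge0_integralZl//; last 2 first.
- apply/measurable_EFinP; apply: measurable_cell_density.
  + exact: measurable_cst.
  + exact: measurable_affine.
  + exact: measurable_cst.
- by move=> u _; rewrite lee_fin cell_density_ge0.
by rewrite totalE tw mule1 /near_origin.
Qed.

End mass_transport.

End uniform_point.

Theorem theorem1 (R : realType) (d : nat) (d_gt0 : (0 < d)%N)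
    (dO : measure_display) (Omega : measurableType dO)
    (P : probability Omega R)
    (lambda : R) (lambda_gt0 : 0 < lambda)
    (Phi : Omega -> set (d.-tuple R))
    (Phi_poisson : poisson_process P lambda Phi)
    (xo : {RV P >-> d.-tuple R})
    (xo_nucleus : zero_cell_nucleus P Phi xo)
    (y : {RV P >-> d.-tuple R})
    (y_uniform : conditionally_uniform P Phi
       (fun w => voronoi_cell (Phi w) (xo w)) y)
    (r : R) (r_ge0 : 0 <= r) :
  cdf (nucleus_distance xo y : {RV P >-> R}) r =
  (1 - expR (- (lambda * kappa d * r ^+ d)))%:E.
Proof.
have lf w : locally_finite (Phi w).
  by move=> B; exact: (pp_locally_finite Phi_poisson).
have mPhi := measurable_process Phi_poisson.
have my : measurable_fun setT y by exact: measurable_funPT.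
have mB := @measurable_closed_ball_at_origin R d r.
have bB := @ebounded_closed_ball R d r.
(* The nucleus [xo] is a nearest point to [y]. *)
transitivity (P [set w | near_within (Phi w) (y w) r]).
  rewrite /cdf /distribution /pushforward; apply: ae_eq_probability.
  - rewrite -[X in measurable X]setTI.
    exact: (@measurable_nucleus_distance _ _ _ _ P xo y measurableT _ (measurable_itv `]-oo, r])).
  - exact: measurable_near_within.
  have untied := untied_nucleus d_gt0 lambda_gt0 Phi_poisson xo_nucleus.
  have in_cell := uniform_point_in_cell d_gt0 lambda_gt0 Phi_poisson xo_nucleus y_uniform.
  apply: filterS2 untied in_cell => w [px x0 ut] yw.
  have [_ yV] := (approx_common_cell_origin (lf w) px x0 ut (y w) (y w)).1 yw.
  rewrite /= in_itv/= /nucleus_distance (propext (near_withinP _ _ (lf w))).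
  split=> [xr|[x [px' xr]]]; first by exists (xo w).
  by rewrite edistC (le_trans (yV _ px')).
rewrite (near_uniform_point_probability d_gt0 lambda_gt0 Phi_poisson xo_nucleus y_uniform).
have mV : measurable [set w | Phi w `&` closed_ball_at_origin r = set0].
  rewrite -[X in measurable X]setTI.
  exact: (mPhi measurableT _ (measurable_void_event mB bB)).
rewrite (_ : [set w | _] = ~` [set w | Phi w `&` closed_ball_at_origin r = set0]).
  rewrite probability_setC// (void_probability Phi_poisson)//.
  by rewrite lebesgue_tuple_closed_ball//= mulrA.
apply/seteqP; split => w /=; rewrite (propext (near_withinP _ _ (lf w))).
  by move=> [x [px xr]] /seteqP[h _]; apply: (h x); split => //;
    rewrite /closed_ball_at_origin /= edistC.
by move=> /eqP/set0P[x [px xr]]; exists x; split => //; rewrite edistC.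
Qed.
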